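(* Let $n\geq 3$, $p,q>0$ with $pq>1$, $\alpha\in(1,n)$ and $\sigma_1,\sigma_2\in[0,\alpha)$. Suppose the subcritical condition $$\frac{n-\sigma_1}{1+q}+\frac{n-\sigma_2}{1+p}>n-\alpha$$ holds. Then the system $$u(x)=\int_{\mathbb{R}^n}\frac{v(y)^q}{|x-y|^{n-\alpha}|y|^{\sigma_1}}\,dy,\qquad v(x)=\int_{\mathbb{R}^n}\frac{u(y)^p}{|x-y|^{n-\alpha}|y|^{\sigma_2}}\,dy,\qquad x\in\mathbb{R}^n,$$ admits no bounded and decaying positive classical solution.
   Context: A classical solution is a solution $u,v\in C^{\lfloor\alpha\rfloor}(\mathbb{R}^n\setminus\{0\})\cap C(\mathbb{R}^n)$, where $\lfloor\cdot\rfloor$ is the greatest integer function; positive means $u,v>0$. The notation $f(x)\simeq g(x)$ means there exist constants $c,C>0$ with $cg(x)\leq f(x)\leq Cg(x)$ as $|x|\to\infty$. A positive solution is called decaying if $u(x)\simeq|x|^{-\theta_1}$ and $v(x)\simeq|x|^{-\theta_2}$ for some $\theta_1,\theta_2>0$. *)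

(* Defs.v *)
From HB Require Import structures.
From mathcomp Require Import all_boot all_order all_algebra.
From mathcomp Require Import all_classical all_reals all_analysis.
Set Implicit Arguments. Unset Strict Implicit. Unset Printing Implicit Defensive.
Import Order.TTheory GRing.Theory Num.Theory.
Import numFieldNormedType.Exports.
Local Open Scope classical_set_scope.
Local Open Scope ring_scope.

Section Defs.
Variable R : realType.

Definition enorm (n : nat) (x : 'rV[R]_n) : R :=
  Num.sqrt (\sum_(i < n) x ord0 i ^+ 2).

Definition ebasis (n : nat) (i : 'I_n) : 'rV[R]_n := delta_mx ord0 i.

(* Lebesgue integral over R^n of a function with values in \bar R, written
   as the iterated one-dimensional Lebesgue integral (Tonelli); for the
   nonnegative measurable integrands used below this is the integral with
   respect to n-dimensional Lebesgue measure. *)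
Fixpoint integral_Rn (n : nat) : ('rV[R]_n -> \bar R) -> \bar R :=
  match n with
  | 0 => fun f => f 0
  | n'.+1 => fun f =>
      (\int[@lebesgue_measure R]_(t in setT)
         integral_Rn (fun y : 'rV[R]_n' => f (row_mx (t%:M : 'rV[R]_1) y)))%E
  end.

Fixpoint Ck_on (n k : nat) (U : set 'rV[R]_n) (f : 'rV[R]_n -> R) : Prop :=
  match k with
  | 0 => forall x, U x -> {for x, continuous f}
  | k'.+1 => (forall x, U x -> {for x, continuous f}) /\
      forall i : 'I_n, (forall x, U x -> derivable f x (ebasis i)) /\
                       Ck_on k' U ('D_(ebasis i) f)
  end.

Definition classical (n : nat) (alpha : R) (f : 'rV[R]_n -> R) : Prop :=
  Ck_on (Num.truncn alpha) (~` [set 0]) f /\ continuous f.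

Definition bounded_fun_Rn (n : nat) (f : 'rV[R]_n -> R) : Prop :=
  exists M : R, forall x, `|f x| <= M.

Definition simeq_pow (n : nat) (f : 'rV[R]_n -> R) (theta : R) : Prop :=
  exists c C R0 : R, 0 < c /\ 0 < C /\
    forall x, R0 <= enorm x ->
      c * enorm x `^ (- theta) <= f x <= C * enorm x `^ (- theta).

Definition riesz_op (n : nat) (alpha sigma e : R) (w : 'rV[R]_n -> R)
    (x : 'rV[R]_n) : \bar R :=
  integral_Rn (fun y => ((w y `^ e) /
     (enorm (x - y) `^ (n%:R - alpha) * enorm y `^ sigma))%:E).

End Defs.

(* Main.v *)
Require Import Defs.
From HB Require Import structures.
From mathcomp Require Import all_boot all_order all_algebra.
From mathcomp Require Import all_classical all_reals all_analysis.
From mathcomp Require Import measurable_realfun ring lra.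
Import Order.TTheory GRing.Theory Num.Theory.
Import numFieldNormedType.Exports.
Local Open Scope classical_set_scope.
Local Open Scope ring_scope.

(** Put [f = v^q |x|^-sigma1] and [g = u^p |x|^-sigma2], so that [u] and [v] are
    the Riesz potentials of [f] and [g].  The Pohozaev identity is replaced by a
    comparison of dilations, which needs no derivative of [u] or [v].  By Tonelli
    and scaling, for every [l > 0],
      [\int f(x) v(l x) dx = l^alpha \int g(l x) u(x) dx],
    and at [l = 1] both sides are the energy [E].  Young's inequality bounds the
    right-hand side from above by [E] times an explicit function of [l].  On the
    left, [ln v(l x)] is Lipschitz in [ln l] uniformly in [x], so a Taylor
    expansion of [v(l x)^(q+1)] around [v(x)^(q+1)] bounds the left-hand side from
    below by [E] times an explicit function of [l], up to [O((ln l)^2)].  For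
    [l = exp (- t)] and small [t > 0] the first-order terms of the two bounds
    contradict subcriticality.

    Positivity, continuity and the decay [u ~ |x|^-theta] make [f] and [g]
    comparable to constants on the balls [|y - x| <= |x| / 2].  This gives the
    Lipschitz bound ([alpha > 1] makes the differentiated kernel integrable), and
    also [u >= c f |x|^alpha] and [v >= c g |x|^alpha].  Combined, the latter two
    force [v <= C |x|^-theta*] for the self-similar exponent [theta*], and
    subcriticality says exactly that this makes [E] finite. *)

(** * Rows as a measurable space *)

Section RowMeasurable.
Context {R : realType} {n : nat}.

Let coors : 'I_n -> 'rV[R]_n -> R := fun i x => x ord0 i.

Let row_set0 : g_sigma_preimage coors set0.
Proof. exact: sigma_algebra0. Qed.

Let row_setC A : g_sigma_preimage coors A -> g_sigma_preimage coors (~` A).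
Proof. exact: sigma_algebraC. Qed.

Let row_bigcup (F : _^nat) : (forall i, g_sigma_preimage coors (F i)) ->
  g_sigma_preimage coors (\bigcup_i (F i)).
Proof. exact: sigma_algebra_bigcup. Qed.

(** The sigma-algebra generated by the coordinates: measurability into rows can be checked one
    coordinate at a time, and [row_cons] is measurable, which the inductions on the dimension rely
    on. *)
HB.instance Definition _ := @isMeasurable.Build (measure_tuple_display
  default_measure_display)
  'rV[R]_n (g_sigma_preimage coors) row_set0 row_setC row_bigcup.

Lemma measurable_coord (i : 'I_n) :
  measurable_fun [set: 'rV[R]_n] (fun x : 'rV[R]_n => x ord0 i).
Proof.
move=> _ Y mY; rewrite setTI; apply: sub_sigma_algebra => /=.
by rewrite (bigD1 i)//=; left; exists Y => //=; rewrite setTI.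
Qed.

End RowMeasurable.

Lemma measurable_fun_rowP {R : realType} n d (T : measurableType d) (f : T ->
  'rV[R]_n) :
  measurable_fun [set: T] f <->
  (forall i, measurable_fun [set: T] (fun x => f x ord0 i)).
Proof.
split=> [mf i|mf].
  exact: (measurableT_comp (measurable_coord i) mf).
apply: (@measurability _ _ _ _ _ _
  (\big[setU/set0]_(i < n) preimage_set_system setT (fun x : 'rV[R]_n => x ord0
    i) measurable)) => //.
move=> _ [A /= /[swap] <-].
rewrite -bigcup_seq/= => -[i _] [Y mY <-].
rewrite setTI; exact: (mf i).
Qed.

(** * The iterated integral *)

Section IteratedIntegral.
Context {R : realType}.
Implicit Types n m : nat.
Local Notation mu := (@lebesgue_measure R).

Definition row_cons n (t : R) (y : 'rV[R]_n) : 'rV[R]_n.+1 :=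
  row_mx (t%:M : 'rV[R]_1) y.

Lemma row_cons0 n t (y : 'rV[R]_n) : row_cons n t y ord0 ord0 = t.
Proof.
rewrite /row_cons mxE; case: splitP => // j _.
by rewrite [j]ord1 !mxE eqxx mulr1n.
Qed.

Lemma row_consS n t (y : 'rV[R]_n) i : row_cons n t y ord0 (lift ord0 i) = y
  ord0 i.
Proof.
rewrite /row_cons mxE; case: splitP => [j|k] /=; first by rewrite ord1.
by rewrite /bump /= !add1n => -[] /val_inj ->.
Qed.

Lemma measurable_row_cons n d (T : measurableType d) (f : T -> R) (g : T ->
  'rV[R]_n) :
  measurable_fun setT f -> measurable_fun setT g ->
  measurable_fun setT (fun x => row_cons n (f x) (g x)).
Proof.
move=> mf mg; apply/measurable_fun_rowP => i.
case: (unliftP ord0 i) => [j|] ->.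
  under eq_fun do rewrite row_consS.
  exact: (measurableT_comp (measurable_coord j)).
by under eq_fun do rewrite row_cons0.
Qed.

Local Open Scope ereal_scope.

Lemma integral_RnS n (f : 'rV[R]_n.+1 -> \bar R) :
  integral_Rn f = \int[mu]_t integral_Rn (fun y => f (row_cons n t y)).
Proof. by []. Qed.

Lemma eq_integral_Rn n (f g : 'rV[R]_n -> \bar R) :
  f =1 g -> integral_Rn f = integral_Rn g.
Proof. by move=> /funext ->. Qed.

Lemma integral_Rn_ge0 n (f : 'rV[R]_n -> \bar R) :
  (forall x, 0 <= f x) -> 0 <= integral_Rn f.
Proof.
elim: n f => [|n IH] f f0 /=; first exact: f0.
by apply: integral_ge0 => t _; apply: IH.
Qed.

Lemma measurable_uncurry_row_cons n d (T : measurableType d)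
    (f : T -> 'rV[R]_n.+1 -> \bar R) :
  measurable_fun setT (fun z => f z.1 z.2) ->
  measurable_fun setT (fun z : (T * R) * 'rV[R]_n => f z.1.1 (row_cons n z.1.2
    z.2)).
Proof.
move=> mf.
apply: (measurableT_comp (g :=
  fun z : (T * R) * 'rV[R]_n => (z.1.1, row_cons n z.1.2 z.2)) mf) => //.
apply: measurable_fun_pair; first exact: measurableT_comp.
by apply: measurable_row_cons => //; exact: measurableT_comp.
Qed.

(** The parameter space is arbitrary because the induction moves the first coordinate of the row
    into the parameter, replacing [T] by [T * R]; Tonelli in one real variable then closes the
    step. *)
Lemma measurable_integral_Rn n d (T : measurableType d) (f : T -> 'rV[R]_n ->
  \bar R) :
  (forall t y, 0 <= f t y) -> measurable_fun setT (fun z => f z.1 z.2) ->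
  measurable_fun setT (fun t => integral_Rn (f t)).
Proof.
elim: n d T f => [|n IH] d T f f0 mf /=.
  exact: (measurableT_comp mf (pair2_measurable (0%R : 'rV[R]_0))).
have := IH _ _ (fun (z : T * R) y => f z.1 (row_cons n z.2 y))
  (fun z y => f0 _ _) (measurable_uncurry_row_cons _ _ _ _ mf).
move=> /(measurable_fun_fubini_tonelli_F (m2 := mu)); apply.
by move=> z; apply: integral_Rn_ge0 => y.
Qed.

Lemma measurable_section n (f : 'rV[R]_n.+1 -> \bar R) :
  measurable_fun setT f ->
  measurable_fun setT (fun z : R * 'rV[R]_n => f (row_cons n z.1 z.2)).
Proof.
by move=> mf; apply: (measurableT_comp mf); exact: measurable_row_cons.
Qed.

Lemma measurable_section1 n (f : 'rV[R]_n.+1 -> \bar R) t :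
  measurable_fun setT f -> measurable_fun setT (fun y => f (row_cons n t y)).
Proof.
by move=> mf; apply: (measurableT_comp mf); exact: measurable_row_cons.
Qed.

Lemma measurable_inner n (f : 'rV[R]_n.+1 -> \bar R) :
  (forall x, 0 <= f x) -> measurable_fun setT f ->
  measurable_fun setT (fun t => integral_Rn (fun y => f (row_cons n t y))).
Proof.
move=> f0 mf.
apply: (measurable_integral_Rn n _ _ (fun t y => f (row_cons n t y))) => //.
exact: measurable_section.
Qed.

Lemma le_integral_Rn n (f g : 'rV[R]_n -> \bar R) :
  (forall x, 0 <= f x) -> measurable_fun setT f -> measurable_fun setT g ->
  (forall x, f x <= g x) -> integral_Rn f <= integral_Rn g.
Proof.
elim: n f g => [|n IH] f g f0 mf mg fg; first exact: fg.
rewrite !integral_RnS; apply: ge0_le_integral => //.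
- by move=> t _; exact: integral_Rn_ge0.
- exact: measurable_inner.
- by apply: measurable_inner => // x; exact: le_trans (fg x).
- by move=> t _; apply: IH => //; exact: measurable_section1.
Qed.

Lemma integral_RnD n (f g : 'rV[R]_n -> \bar R) :
  (forall x, 0 <= f x) -> (forall x, 0 <= g x) ->
  measurable_fun setT f -> measurable_fun setT g ->
  integral_Rn (fun x => f x + g x) = integral_Rn f + integral_Rn g.
Proof.
elim: n f g => [|n IH] f g f0 g0 mf mg //.
rewrite !integral_RnS -ge0_integralD//; first last.
- exact: measurable_inner.
- by move=> t _; exact: integral_Rn_ge0.
- exact: measurable_inner.
- by move=> t _; exact: integral_Rn_ge0.
apply: eq_integral => t _; apply: IH => //; exact: measurable_section1.
Qed.

Lemma integral_RnZl n (k : \bar R) (f : 'rV[R]_n -> \bar R) :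
  0 <= k -> (forall x, 0 <= f x) -> measurable_fun setT f ->
  integral_Rn (fun x => k * f x) = k * integral_Rn f.
Proof.
move=> k0; elim: n f => [|n IH] f f0 mf //.
rewrite !integral_RnS -ge0_integralZl//; first last.
- by move=> t _; exact: integral_Rn_ge0.
- exact: measurable_inner.
by apply: eq_integral => t _; apply: IH => //; exact: measurable_section1.
Qed.

(** The real variable passes the coordinates of the row one at a time, each exchange being Tonelli
    in the plane. *)
Lemma integral_Rn_int_swap n (f : R -> 'rV[R]_n -> \bar R) :
  (forall t y, 0 <= f t y) -> measurable_fun setT (fun z => f z.1 z.2) ->
  \int[mu]_t integral_Rn (f t) = integral_Rn (fun y => \int[mu]_t f t y).
Proof.
elim: n f => [|n IH] f f0 mf //.
rewrite integral_RnS.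
under eq_integral do rewrite integral_RnS.
have mf' := measurable_uncurry_row_cons _ _ _ _ mf.
transitivity (\int[mu]_s \int[mu]_t integral_Rn (fun y => f t (row_cons n s y))).
  apply: (fubini_tonelli (m1 := mu) (m2 := mu)
    (fun z : R * R => integral_Rn (fun y => f z.1 (row_cons n z.2 y)))).
    exact: (measurable_integral_Rn n _ _
      (fun (z : R * R) y => f z.1 (row_cons n z.2 y))).
  by move=> z; exact: integral_Rn_ge0.
apply: eq_integral => s _; apply: IH => //.
apply: (measurableT_comp (g :=
  fun z : R * 'rV[R]_n => (z.1, row_cons n s z.2)) mf) => //.
by apply: measurable_fun_pair => //; exact: measurable_row_cons.
Qed.

(** Induction on the first dimension: the induction hypothesis exchanges all but one coordinate, and
    [integral_Rn_int_swap] the remaining one. *)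
Lemma integral_Rn_swap n m (f : 'rV[R]_n -> 'rV[R]_m -> \bar R) :
  (forall t y, 0 <= f t y) -> measurable_fun setT (fun z => f z.1 z.2) ->
  integral_Rn (fun x => integral_Rn (f x)) =
  integral_Rn (fun y => integral_Rn (fun x => f x y)).
Proof.
elim: n f => [|n IH] f f0 mf //.
rewrite integral_RnS.
have mrow : measurable_fun setT
    (fun z : (R * 'rV[R]_m) * 'rV[R]_n => f (row_cons n z.1.1 z.2) z.1.2).
  apply: (measurableT_comp (g :=
    fun z : (R * 'rV[R]_m) * 'rV[R]_n => (row_cons n z.1.1 z.2, z.1.2)) mf) => //.
  apply: measurable_fun_pair; last exact: measurableT_comp.
  by apply: measurable_row_cons => //; exact: measurableT_comp.
transitivity (\int[mu]_t
    integral_Rn (fun y => integral_Rn (fun x => f (row_cons n t x) y))).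
  apply: eq_integral => t _; apply: IH => //.
  apply: (measurableT_comp (g :=
    fun z : 'rV[R]_n * 'rV[R]_m => (row_cons n t z.1, z.2)) mf) => //.
  apply: measurable_fun_pair => //.
  exact: measurable_row_cons.
rewrite integral_Rn_int_swap//.
  by move=> t y; exact: integral_Rn_ge0.
exact: (measurable_integral_Rn n _ _
  (fun (z : R * 'rV[R]_m) y => f (row_cons n z.1 y) z.2)).
Qed.

End IteratedIntegral.

(** * Affine changes of variables, monotone convergence and cubes *)

Section AffineChange.
Context {R : realType}.
Local Notation mu := (@lebesgue_measure R).
Local Open Scope ereal_scope.

(** The right-hand side is a measure in [A], a scaled pushforward of Lebesgue measure, and it gives
    half-open intervals their length; uniqueness of Lebesgue measure does the rest. *)
Lemma lebesgue_measure_affine (a r : R) (A : set R) : (0 < r)%R -> measurable A ->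
  mu A = r%:E * mu ((fun t => (a + r * t)%R) @^-1` A).
Proof.
move=> r0 mA.
have mphi : @measurable_fun _ _ (measurableTypeR R) (measurableTypeR R) setT
    (fun t : R => (a + r * t)%R).
  by apply: measurable_funD => //; exact: mulrl_measurable.
pose phi : measurableTypeR R -> measurableTypeR R := fun t => (a + r * t)%R.
pose nu : {measure set (measurableTypeR R) -> \bar R} :=
  mscale (NngNum (ltW r0)) (pushforward mu phi).
rewrite -[RHS]/(nu mphi A); apply: lebesgue_measure_unique => //= _ [[b c]] _ <-.
have E : phi @^-1` `]b, c]%classic = `]((b - a) / r)%R, ((c - a) / r)%R]%classic.
  apply/seteqP; split => t; rewrite /phi /= !in_itv /=.
    by rewrite ltr_pdivrMr// ler_pdivlMr// => /andP[? ?]; apply/andP; split; lra.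
  by rewrite ltr_pdivrMr// ler_pdivlMr// => /andP[? ?]; apply/andP; split; lra.
rewrite [RHS](_ : _ = r%:E * mu (phi @^-1` `]b, c]%classic))// E
  !lebesgue_measure_itv /= !lte_fin.
have -> : ((b - a) / r < (c - a) / r)%R = (b < c)%R.
  by rewrite ltr_pM2r ?invr_gt0// ltrD2r.
case: ifP => _; last by rewrite mule0.
rewrite -!EFinB -EFinM; congr EFin; field; exact: lt0r_neq0.
Qed.

Lemma ge0_integral_affine (a r : R) (f : R -> \bar R) : (0 < r)%R ->
  (forall t, 0 <= f t) -> measurable_fun setT f ->
  \int[mu]_t f t = r%:E * \int[mu]_t f (a + r * t)%R.
Proof.
move=> r0 f0 mf.
have mphi : @measurable_fun _ _ (measurableTypeR R) (measurableTypeR R) setT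
    (fun t : R => (a + r * t)%R).
  by apply: measurable_funD => //; exact: mulrl_measurable.
pose phi : measurableTypeR R -> measurableTypeR R := fun t => (a + r * t)%R.
pose nu : {measure set (measurableTypeR R) -> \bar R} := pushforward mu phi.
transitivity (\int[mscale (NngNum (ltW r0)) (nu mphi)]_t f t).
  by apply: eq_measure_integral => A mA _; exact: lebesgue_measure_affine.
rewrite ge0_integral_mscale//=; congr (_ * _).
by rewrite (ge0_integral_pushforward mphi)//= preimage_setT.
Qed.

Lemma scale_row_cons n (a : 'rV[R]_n.+1) r t y :
  (a + r *: row_cons n t y)%R =
  row_cons n (a ord0 ord0 + r * t)%R ((\row_i a ord0 (lift ord0 i)) + r *: y)%R.
Proof.
apply/rowP => i; rewrite [LHS]mxE [X in (_ + X)%R]mxE.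
case: (unliftP ord0 i) => [j|] ->; last by rewrite !row_cons0.
by rewrite !row_consS !mxE.
Qed.

Lemma measurable_affine_row n (a : 'rV[R]_n) (r : R) :
  measurable_fun setT (fun x : 'rV[R]_n => (a + r *: x)%R).
Proof.
apply/measurable_fun_rowP => i.
under eq_fun do rewrite !mxE.
apply: measurable_funD => //; apply: measurable_funM => //.
exact: measurable_coord.
Qed.

Lemma integral_Rn_affine n (a : 'rV[R]_n) (r : R) (f : 'rV[R]_n -> \bar R) :
  (0 < r)%R -> (forall x, 0 <= f x) -> measurable_fun setT f ->
  integral_Rn f = (r ^+ n)%:E * integral_Rn (fun x => f (a + r *: x)%R).
Proof.
move=> r0; elim: n a f => [|n IH] a f f0 mf.
  by rewrite /= expr0 mul1e; congr f; apply/rowP => -[].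
pose b := (\row_i a ord0 (lift ord0 i))%R.
rewrite !integral_RnS (ge0_integral_affine (a ord0 ord0) r)//; first last.
- exact: measurable_inner.
- by move=> t; exact: integral_Rn_ge0.
rewrite exprS EFinM -muleA; congr (_ * _).
rewrite -ge0_integralZl//; first last.
- by rewrite lee_fin exprn_ge0// ltW.
- by move=> t _; exact: integral_Rn_ge0.
- apply: (measurable_inner _ (fun x => f (a + r *: x)%R)) => //.
  exact: measurableT_comp (measurable_affine_row _ _ _).
apply: eq_integral => t _.
rewrite (IH b)//; last exact: measurable_section1.
by congr (_ * _); apply: eq_integral_Rn => y; rewrite scale_row_cons.
Qed.

Lemma integral_Rn_monotone n (f : nat -> 'rV[R]_n -> \bar R) (g : 'rV[R]_n ->
  \bar R) :
  (forall k x, 0 <= f k x) -> (forall k, measurable_fun setT (f k)) ->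
  (forall x k l, (k <= l)%N -> f k x <= f l x) ->
  (forall x, f k x @[k --> \oo] --> g x) ->
  integral_Rn (f k) @[k --> \oo] --> integral_Rn g.
Proof.
elim: n f g => [|n IH] f g f0 mf ndf fg; first exact: fg.
rewrite integral_RnS.
have cvg_inner t : integral_Rn (fun y => f k (row_cons n t y)) @[k --> \oo]
    --> integral_Rn (fun y => g (row_cons n t y)).
  apply: IH => //.
  - by move=> k; exact: measurable_section1.
  - by move=> x k l kl; exact: ndf.
have nd_inner t k l : (k <= l)%N -> integral_Rn (fun y => f k (row_cons n t y)) <=
    integral_Rn (fun y => f l (row_cons n t y)).
  move=> kl; apply: le_integral_Rn => //; try exact: measurable_section1.
  by move=> y; exact: ndf.
have -> : \int[mu]_t integral_Rn (fun y => g (row_cons n t y)) =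
   \int[mu]_t (limn (fun k => integral_Rn (fun y => f k (row_cons n t y)))).
  by apply: eq_integral => t _; apply/esym/cvg_lim => //; exact: cvg_inner.
apply: cvg_monotone_convergence => //.
- by move=> k; exact: measurable_inner.
- by move=> k t _; exact: integral_Rn_ge0.
- by move=> t _ k l; exact: nd_inner.
Qed.

(** The indicator of an open cube, written as a product so that its iterated integral factors. *)
Definition cube_fun n (a b : R) (x : 'rV[R]_n) : R :=
  (\prod_(i < n) \1_(`]a, b[%classic) (x ord0 i))%R.

Lemma cube_fun_ge0 n a b x : (0 <= cube_fun n a b x)%R.
Proof. by apply: prodr_ge0 => i _; rewrite indicE. Qed.

Lemma measurable_cube_fun n a b : measurable_fun setT (cube_fun n a b).
Proof.
apply: measurable_prod => i _.
apply: measurableT_comp; last exact: measurable_coord.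
exact: measurable_indic.
Qed.

Lemma integral_cube n (a b : R) : (a <= b)%R ->
  integral_Rn (fun x => (cube_fun n a b x)%:E) = ((b - a) ^+ n)%:E.
Proof.
move=> ab; elim: n => [|n IH].
  by rewrite /= /cube_fun big_ord0 expr0.
rewrite integral_RnS.
transitivity (\int[mu]_t (((b - a) ^+ n)%:E * (\1_(`]a, b[%classic) t)%:E)).
  apply: eq_integral => t _; rewrite -IH muleC -integral_RnZl//; first last.
  - by apply/measurable_EFinP; exact: measurable_cube_fun.
  - by move=> x; rewrite lee_fin cube_fun_ge0.
  apply: eq_integral_Rn => y; rewrite -EFinM; congr EFin.
  rewrite /cube_fun big_ord_recl row_cons0; congr (_ * _)%R.
  by apply: eq_bigr => i _; rewrite row_consS.
rewrite ge0_integralZl//; first last.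
- by rewrite lee_fin exprn_ge0// subr_ge0.
- by apply/measurable_EFinP; exact: measurable_indic.
rewrite integral_indic//= setIT lebesgue_measure_itv /= lte_fin.
move: ab; rewrite le_eqVlt => /predU1P[->|->].
  by rewrite ltxx mule0 subrr exprS mul0r.
by rewrite -EFinB -EFinM exprSr.
Qed.

End AffineChange.

(** * Measurability of continuous functions, Euclidean norm *)

Section RowCalculus.
Context {R : realType}.

(** Integer coordinates make the set of values countable; [k.+1] keeps the mesh [1 / (k + 1)]
    meaningful at [k = 0]. *)
Definition discretize n (k : nat) (x : 'rV[R]_n) : 'rV[int]_n :=
  \row_i Num.floor (k.+1%:R * x ord0 i).

Definition grid_point n (k : nat) (z : 'rV[int]_n) : 'rV[R]_n :=
  \row_i ((z ord0 i)%:~R / k.+1%:R).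

Lemma measurable_discretize_fiber n k (z : 'rV[int]_n) :
  measurable [set x : 'rV[R]_n | discretize n k x = z].
Proof.
have -> : [set x : 'rV[R]_n | discretize n k x = z] = \bigcap_(i in [set: 'I_n])
    ((fun x : 'rV[R]_n => k.+1%:R * x ord0 i) @^-1`
     `[(z ord0 i)%:~R, (z ord0 i + 1)%:~R[%classic).
  apply/seteqP; split => [x /= <- i _|x xz] /=.
    by rewrite mxE in_itv /= floor_itv.
  apply/rowP => i; rewrite mxE; apply/eqP; rewrite floor_eq.
  by have := xz i I; rewrite /= in_itv.
apply: fin_bigcap_measurable => // i _.
rewrite -[X in measurable X]setTI.
have : measurable_fun [set: 'rV[R]_n] (fun x => k.+1%:R * x ord0 i).
  by apply: measurable_funM => //; exact: measurable_coord.
by apply => //; exact: measurable_itv.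
Qed.

Lemma grid_point_cvg n (x : 'rV[R]_n) :
  grid_point n k (discretize n k x) @[k --> \oo] --> x.
Proof.
apply/cvgrPdist_lt => e e0.
near=> k.
rewrite [X in X < _]/Num.norm /= mx_normrE; apply: bigmax_lt => // -[a i] _ /=.
rewrite (ord1 a) !mxE.
have k0 : 0 < k.+1%:R :> R by rewrite ltr0n.
have /andP[h1 h2] := floor_itv (k.+1%:R * x ord0 i).
rewrite (_ : _ - _ = (k.+1%:R * x ord0 i - (Num.floor (k.+1%:R * x ord0 i))%:~R)
  / k.+1%:R); last by field; exact: lt0r_neq0.
rewrite ger0_norm; last by rewrite divr_ge0 ?subr_ge0// ltW.
apply: (@le_lt_trans _ _ (k.+1%:R^-1)).
  rewrite ler_pdivrMr// mulVf ?lt0r_neq0//.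
  by move: h2; rewrite intrD => h2; lra.
near: k; exact: near_infty_natSinv_lt (PosNum e0).
Unshelve. all: by end_near. Qed.

(* [f] is the pointwise limit of its compositions with rounding to a grid, and
   those take countably many values. *)
Lemma continuous_measurable_fun_row n (f : 'rV[R]_n -> R) :
  continuous f -> measurable_fun setT f.
Proof.
move=> cf.
apply: (@measurable_fun_cvg _ _ _ _
  (fun k x => f (grid_point n k (discretize n k x)))).
  move=> k _ Y mY; rewrite setTI.
  have -> : (fun x => f (grid_point n k (discretize n k x))) @^-1` Y =
    \bigcup_(z : 'rV[int]_n) (if `[< Y (f (grid_point n k z)) >]
       then [set x : 'rV[R]_n | discretize n k x = z] else set0).
    apply/seteqP; split => x /=.
      move=> Yx; exists (discretize n k x) => //.
      by case: asboolP => //.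
    by move=> [z _]; case: asboolP => // Yz /= ->.
  apply: countable_bigcupT_measurable; first exact: countableP.
  by move=> z; case: asboolP => // _; exact: measurable_discretize_fiber.
move=> x _; exact: (cvg_comp _ _ (grid_point_cvg n x) (cf x)).
Qed.

Definition edot n (x y : 'rV[R]_n) : R := \sum_i x ord0 i * y ord0 i.

Lemma enorm_ge0 n (x : 'rV[R]_n) : 0 <= enorm x.
Proof. exact: sqrtr_ge0. Qed.

Lemma enorm_sqr n (x : 'rV[R]_n) : enorm x ^+ 2 = edot n x x.
Proof.
rewrite /enorm sqr_sqrtr; last by apply: sumr_ge0 => i _; exact: sqr_ge0.
by apply: eq_bigr => i _; rewrite expr2.
Qed.

(** Cauchy-Schwarz: with [A = edot n x x], the squared norm of [A y - (edot n x y) x] is nonnegative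
    and equals [A] times the discriminant. Cancelling [A] requires the case [A = 0] to be settled
    first. *)
Lemma edot_le n (x y : 'rV[R]_n) : edot n x y <= enorm x * enorm y.
Proof.
have [x0|x0] := eqVneq (edot n x x) 0.
  have xi i : x ord0 i = 0.
    have /psumr_eq0P : forall i : 'I_n, true -> 0 <= x ord0 i * x ord0 i.
      by move=> j _; rewrite -expr2 sqr_ge0.
    by move=> /(_ x0 i isT) /eqP; rewrite mulf_eq0 orbb => /eqP.
  rewrite /edot big1 ?mulr_ge0 ?enorm_ge0// => i _.
  by rewrite xi mul0r.
have Agt0 : 0 < edot n x x by rewrite lt0r x0 -enorm_sqr sqr_ge0.
suff H : edot n x y ^+ 2 <= edot n x x * edot n y y.
  apply: le_trans (ler_norm _) _.
  rewrite -(@ler_pXn2r _ 2) ?nnegrE ?mulr_ge0 ?enorm_ge0//.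
  by rewrite real_normK ?num_real// exprMn !enorm_sqr.
have : 0 <= \sum_i (edot n x x * y ord0 i - edot n x y * x ord0 i) ^+ 2.
  by apply: sumr_ge0 => i _; exact: sqr_ge0.
have -> : \sum_i (edot n x x * y ord0 i - edot n x y * x ord0 i) ^+ 2 =
    edot n x x * (edot n x x * edot n y y - edot n x y ^+ 2).
  transitivity (\sum_i (edot n x x ^+ 2 * (y ord0 i * y ord0 i)
     - (2 * edot n x x * edot n x y) * (x ord0 i * y ord0 i)
     + edot n x y ^+ 2 * (x ord0 i * x ord0 i))).
    by apply: eq_bigr => i _; ring.
  rewrite big_split /= sumrB -!mulr_sumr -/(edot n x x) -/(edot n x y) -/(edot
    n y y).
  ring.
by rewrite pmulr_rge0// subr_ge0.
Qed.

Lemma ler_enormD n (x y : 'rV[R]_n) : enorm (x + y) <= enorm x + enorm y.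
Proof.
rewrite -(@ler_pXn2r _ 2) ?nnegrE ?addr_ge0 ?enorm_ge0//.
rewrite sqrrD !enorm_sqr.
have -> : edot n (x + y) (x + y) = edot n x x + edot n x y *+ 2 + edot n y y.
  rewrite /edot -sumrMnl -!big_split /=; apply: eq_bigr => i _; rewrite !mxE;
    ring.
by rewrite lerD2r lerD2l lerMn2r/= edot_le.
Qed.

Lemma enormZ n (a : R) (x : 'rV[R]_n) : enorm (a *: x) = `|a| * enorm x.
Proof.
rewrite /enorm -sqrtr_sqr -sqrtrM ?sqr_ge0//; congr Num.sqrt.
by rewrite mulr_sumr; apply: eq_bigr => i _; rewrite mxE exprMn.
Qed.

Lemma enormN n (x : 'rV[R]_n) : enorm (- x) = enorm x.
Proof. by rewrite -scaleN1r enormZ normrN1 mul1r. Qed.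

Lemma enorm_subC n (x y : 'rV[R]_n) : enorm (x - y) = enorm (y - x).
Proof. by rewrite -opprB enormN. Qed.

Lemma enorm_eq0 n (x : 'rV[R]_n) : (enorm x == 0) = (x == 0).
Proof.
apply/eqP/eqP => [x0|->]; last first.
  by rewrite -(scale0r 0) enormZ normr0 mul0r.
apply/rowP => i; rewrite mxE.
have /psumr_eq0P : forall i : 'I_n, true -> 0 <= x ord0 i * x ord0 i.
  by move=> j _; rewrite -expr2 sqr_ge0.
rewrite -/(edot n x x) -enorm_sqr x0 expr0n => /(_ erefl i isT) /eqP.
by rewrite mulf_eq0 orbb => /eqP.
Qed.

Lemma normr_coord_le_enorm n (x : 'rV[R]_n) i : `|x ord0 i| <= enorm x.
Proof.
rewrite -sqrtr_sqr /enorm ler_wsqrtr// (bigD1 i)//= lerDl.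
by apply: sumr_ge0 => j _; exact: sqr_ge0.
Qed.

Lemma enorm_sqr_le n (x : 'rV[R]_n) (b : R) :
  (forall i, `|x ord0 i| <= b) -> enorm x ^+ 2 <= n%:R * b ^+ 2.
Proof.
move=> xb; rewrite enorm_sqr /edot.
apply: (@le_trans _ _ (\sum_(i < n) b ^+ 2)); last first.
  by rewrite sumr_const card_ord mulr_natl.
apply: ler_sum => i _; rewrite -expr2 -real_normK ?num_real//.
by rewrite ler_pXn2r ?nnegrE// (le_trans _ (xb i)).
Qed.

Lemma measurable_enorm n : measurable_fun setT (@enorm R n).
Proof.
have -> : @enorm R n = fun x => (\sum_(i < n) x ord0 i ^+ 2) `^ (2^-1).
  apply/funext => x; rewrite powR12_sqrt//.
  by apply: sumr_ge0 => i _; exact: sqr_ge0.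
apply: (measurableT_comp (measurable_powR _)).
apply: measurable_sum => i; apply: measurable_funX; exact: measurable_coord.
Qed.

End RowCalculus.

(** * Power functions on annuli *)

Section RadialIntegrals.
Context {R : realType}.

Lemma ler_powRN (a b s : R) : 0 < a -> a <= b -> 0 <= s -> b `^ (- s) <= a `^
  (- s).
Proof.
move=> a0 ab s0; rewrite !powRN lef_pV2 ?posrE ?powR_gt0//; last exact:
  lt_le_trans ab.
by rewrite ge0_ler_powR// ?nnegrE ltW// (lt_le_trans a0).
Qed.

(* The lower bound is strict so that taking [a = 0] excludes [x = 0], where the
   power is a junk value. *)
Definition annulus n (s a b : R) (x : 'rV[R]_n) : R :=
  if a < enorm x <= b then enorm x `^ (- s) else 0.

Lemma annulus_ge0 n s a b (x : 'rV[R]_n) : 0 <= annulus n s a b x.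
Proof. by rewrite /annulus; case: ifP => // _; exact: powR_ge0. Qed.

Lemma measurable_annulus n s a b : measurable_fun setT (annulus n s a b).
Proof.
have mn := @measurable_enorm R n.
apply: measurable_fun_ifT => //.
- apply: measurable_and; first exact: measurable_fun_ltr.
  exact: measurable_fun_ler.
- exact: (measurableT_comp (measurable_powR _)).
Qed.

Lemma measurable_annulus_EFin n s a b :
  measurable_fun setT (fun x : 'rV[R]_n => (annulus n s a b x)%:E).
Proof. by apply/measurable_EFinP; exact: measurable_annulus. Qed.

Lemma annulusD n s a b c (x : 'rV[R]_n) : a <= b -> b <= c ->
  annulus n s a c x = annulus n s a b x + annulus n s b c x.
Proof.
move=> ab bc; rewrite /annulus.
have [xa|ax] := leP (enorm x) a.
  by rewrite /= add0r ltNge (le_trans xa ab).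
have [xb|bx] := leP (enorm x) b; first by rewrite (le_trans xb bc) /= addr0.
by rewrite /= add0r.
Qed.

Lemma cube_fun_1 n (b : R) (x : 'rV[R]_n) : enorm x < b -> cube_fun n (- b) b x
  = 1.
Proof.
move=> xb; rewrite /cube_fun big1// => i _; rewrite indicE mem_set//= in_itv /=.
by rewrite -ltr_norml (le_lt_trans (normr_coord_le_enorm _ _ _)).
Qed.

(** On the annulus the power is at most its value at one of the two radii, which one depending on
    the sign of [s]; the sum covers both. The half-side is [b + 1] because the cube is open and must
    contain the sphere of radius [b]. *)
Lemma annulus_le_cube n s a b (x : 'rV[R]_n) : 0 < a -> a <= b ->
  annulus n s a b x <= (a `^ (- s) + b `^ (- s)) * cube_fun n (- (b + 1)) (b +
    1) x.
Proof.
move=> a0 ab; rewrite /annulus; case: ifP => [/andP[ax xb]|_]; last first.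
  by rewrite mulr_ge0 ?cube_fun_ge0// addr_ge0// powR_ge0.
rewrite cube_fun_1 ?mulr1; last by rewrite ltr_pwDr.
have x0 : 0 < enorm x := lt_trans a0 ax.
have [s0|s0] := leP 0 s.
  by rewrite (le_trans (ler_powRN _ _ _ a0 (ltW ax) s0))// lerDl powR_ge0.
rewrite (@le_trans _ _ (b `^ (- s)))//; last by rewrite lerDr powR_ge0.
rewrite ge0_ler_powR// ?nnegrE ?oppr_ge0 ltW//.
exact: lt_le_trans xb.
Qed.

Lemma annulus_scale n s a b r (x : 'rV[R]_n) : 0 < r ->
  annulus n s (r * a) (r * b) (0 + r *: x) = r `^ (- s) * annulus n s a b x.
Proof.
move=> r0; rewrite /annulus add0r enormZ gtr0_norm// ltr_pM2l// ler_pM2l//.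
by case: ifP => _; rewrite ?mulr0// powRM ?enorm_ge0// ltW.
Qed.

Local Open Scope ereal_scope.

Lemma integral_annulus_fin n s a b : (0 < a)%R -> (a <= b)%R ->
  integral_Rn (fun x : 'rV[R]_n => (annulus n s a b x)%:E) \is a fin_num.
Proof.
move=> a0 ab.
rewrite ge0_fin_numE; last by apply: integral_Rn_ge0 => x; rewrite lee_fin
  annulus_ge0.
pose C := (a `^ (- s) + b `^ (- s))%R.
apply: (@le_lt_trans _ _ (integral_Rn (fun x : 'rV[R]_n =>
    C%:E * (cube_fun n (- (b + 1)) (b + 1) x)%:E))).
  apply: le_integral_Rn.
  - by move=> x; rewrite lee_fin annulus_ge0.
  - exact: measurable_annulus_EFin.
  - by apply: measurable_funeM; apply/measurable_EFinP; exact: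
    measurable_cube_fun.
  - by move=> x; rewrite -EFinM lee_fin annulus_le_cube.
rewrite integral_RnZl//; first last.
- by apply/measurable_EFinP; exact: measurable_cube_fun.
- by move=> x; rewrite lee_fin cube_fun_ge0.
- by rewrite lee_fin addr_ge0// powR_ge0.
rewrite integral_cube; last by rewrite ge0_cp ?addr_ge0 ?(le_trans (ltW a0) ab).
by rewrite -EFinM ltry.
Qed.

Lemma integral_annulus_scale n s a b r : (0 < r)%R ->
  integral_Rn (fun x : 'rV[R]_n => (annulus n s (r * a) (r * b) x)%:E) =
  (r `^ (n%:R - s))%:E * integral_Rn (fun x : 'rV[R]_n => (annulus n s a b x)%:E).
Proof.
move=> r0.
have -> : (r `^ (n%:R - s) = r ^+ n * r `^ (- s))%R.
  by rewrite powRD ?(lt0r_neq0 r0) ?implybT// (powR_mulrn n (ltW r0)).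
etransitivity.
  apply: (integral_Rn_affine n 0 r) => //.
  - by move=> x; rewrite lee_fin annulus_ge0.
  - exact: measurable_annulus_EFin.
rewrite EFinM -muleA; congr (_ * _).
rewrite -integral_RnZl//; first last.
- exact: measurable_annulus_EFin.
- by move=> x; rewrite lee_fin annulus_ge0.
- by rewrite lee_fin powR_ge0.
by apply: eq_integral_Rn => x; rewrite annulus_scale// EFinM.
Qed.

Lemma integral_annulusD n s a b c : (a <= b)%R -> (b <= c)%R ->
  integral_Rn (fun x : 'rV[R]_n => (annulus n s a c x)%:E) =
  integral_Rn (fun x : 'rV[R]_n => (annulus n s a b x)%:E) +
  integral_Rn (fun x : 'rV[R]_n => (annulus n s b c x)%:E).
Proof.
move=> ab bc; rewrite -integral_RnD; first last.
- exact: measurable_annulus_EFin.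
- exact: measurable_annulus_EFin.
- by move=> x; rewrite lee_fin annulus_ge0.
- by move=> x; rewrite lee_fin annulus_ge0.
by apply: eq_integral_Rn => x; rewrite (annulusD _ _ a b c)// EFinD.
Qed.

(** Monotone convergence, in the form used for truncations: at each point these are eventually equal
    to the limit. *)
Lemma integral_Rn_le_limit n (f : nat -> 'rV[R]_n -> R) (g : 'rV[R]_n -> R) (C
  : \bar R) :
  (forall k x, (0 <= f k x)%R) -> (forall k, measurable_fun setT (f k)) ->
  (forall x k l, (k <= l)%N -> (f k x <= f l x)%R) ->
  (forall x, \forall k \near \oo, f k x = g x) ->
  (forall k, integral_Rn (EFin \o f k) <= C) -> integral_Rn (EFin \o g) <= C.
Proof.
move=> f0 mf ndf fg fC.
have H : integral_Rn (EFin \o f k) @[k --> \oo] --> integral_Rn (EFin \o g).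
  apply: (integral_Rn_monotone _ (fun k => EFin \o f k)).
  - by move=> k x; rewrite lee_fin.
  - by move=> k; apply/measurable_EFinP.
  - by move=> x k l kl; rewrite lee_fin ndf.
  - move=> x; apply: cvg_near_cst.
    by apply: filterS (fg x) => k /= ->.
have <- := cvg_lim _ H => //.
apply: lime_le; first by apply/cvg_ex; eexists; exact: H.
by near=> k; exact: fC.
Unshelve. all: by end_near. Qed.

Lemma annulusS n s a b a' b' (x : 'rV[R]_n) : (a' <= a)%R -> (b <= b')%R ->
  (annulus n s a b x <= annulus n s a' b' x)%R.
Proof.
move=> aa bb; rewrite /annulus; case: ifP => [/andP[ax xb]|_].
  by rewrite (le_lt_trans aa ax) (le_trans xb bb).
by case: ifP => // _; exact: powR_ge0.
Qed.

(** The bound is the fixed point of [z -> A + t z], hence is preserved by the recursion. *)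
Lemma geometric_bound (u : nat -> \bar R) (A : \bar R) (t : R) :
  (0 <= t)%R -> (t < 1)%R -> A \is a fin_num -> 0 <= A -> u 0%N = 0 ->
  (forall k, u k.+1 = A + t%:E * u k) ->
  forall k, u k <= (fine A / (1 - t))%:E.
Proof.
move=> t0 t1 Afin A0 u0 uS; elim=> [|k IH].
  by rewrite u0 lee_fin divr_ge0 ?fine_ge0// subr_ge0 ltW.
have t1' : (1 - t)%R != 0%R by rewrite subr_eq0 gt_eqF.
rewrite uS -(fineK Afin) (_ : fine A / (1 - t) = fine A + t * (fine A / (1 -
  t)))%R; last by field.
by rewrite EFinD EFinM leeD2l// lee_wpmul2l.
Qed.

Lemma integral_annulus0 n s a : integral_Rn (fun x : 'rV[R]_n => (annulus n s a
  a x)%:E) = 0.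
Proof.
transitivity (integral_Rn (fun x : 'rV[R]_n => 0 * (annulus n s a a x)%:E)).
  apply: eq_integral_Rn => x; rewrite mul0e /annulus.
  by case: ifP => // /andP[/lt_le_trans] h /h; rewrite ltxx.
rewrite integral_RnZl ?mul0e//; first by move=> x; rewrite lee_fin annulus_ge0.
exact: measurable_annulus_EFin.
Qed.

Lemma integral_annulus_ge0 n s a b :
  0 <= integral_Rn (fun x : 'rV[R]_n => (annulus n s a b x)%:E).
Proof. by apply: integral_Rn_ge0 => x; rewrite lee_fin annulus_ge0. Qed.

(* Scaling by [1/2] turns the integral over [2^-(k+1) < |x| <= 1] into a constant
   plus a multiple, with ratio less than 1, of the one over [2^-k < |x| <= 1]. *)
Lemma integral_annulus_near0 n s : (s < n%:R)%R ->
  integral_Rn (fun x : 'rV[R]_n => (annulus n s 0 1 x)%:E) < +oo.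
Proof.
move=> sn.
pose u k := integral_Rn (fun x : 'rV[R]_n => (annulus n s (2^-1 ^+ k) 1 x)%:E).
pose A := integral_Rn (fun x : 'rV[R]_n => (annulus n s 2^-1 1 x)%:E).
pose t : R := (2^-1 `^ (n%:R - s))%R.
have h0 : (0 < 2^-1 :> R)%R by rewrite invr_gt0.
have h1 : (2^-1 <= 1 :> R)%R by rewrite invf_le1// ler1n.
apply: (@le_lt_trans _ _ (fine A / (1 - t))%:E); last exact: ltry.
apply: (integral_Rn_le_limit _ (fun k => annulus n s (2^-1 ^+ k) 1)).
- by move=> k x; exact: annulus_ge0.
- by move=> k; exact: measurable_annulus.
- by move=> x k l kl; apply: annulusS => //; rewrite ler_wiXn2l// ltW.
- move=> x; have [x0|x0] := eqVneq (enorm x) 0%R.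
    (* At the origin every truncation and the limit vanish, by the strict inner inequality. *)
    near=> k; rewrite /annulus x0 ltxx /=.
    by rewrite ltNge exprn_ge0 ?ltW.
  have c : (GRing.exp (2^-1 : R) : nat -> R) @ \oo --> (0 : R)%R.
    by apply: cvg_expr; rewrite ger0_norm ?ltW// invf_lt1// ltr1n.
  have xp : (0 < enorm x)%R by rewrite lt0r x0 enorm_ge0.
  move/cvgrPdist_lt : c => /(_ _ xp); apply: filterS => k.
  rewrite sub0r normrN ger0_norm ?exprn_ge0 ?ltW// => h.
  by rewrite /annulus h xp.
- apply: (geometric_bound u) => //.
  + exact: powR_ge0.
  + rewrite [ltRHS](_ : _ = 1 `^ (n%:R - s))%R; last by rewrite powR1.
    by rewrite gt0_ltr_powR ?subr_gt0 ?nnegrE ?ltW// invf_lt1// ltr1n.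
  + exact: integral_annulus_fin.
  + exact: integral_annulus_ge0.
  + by rewrite /u expr0 integral_annulus0.
  + move=> k; rewrite /u (integral_annulusD _ _ _ (2^-1)%R)//; last first.
      by rewrite exprS; apply: ler_piMr (ltW h0) (exprn_ile1 _ (ltW h0) h1).
    rewrite addeC; congr (_ + _); rewrite /t -integral_annulus_scale//.
    by rewrite mulr1 exprS.
Unshelve. all: by end_near. Qed.

Definition exterior n (s : R) (x : 'rV[R]_n) : R :=
  if (1 < enorm x)%R then (enorm x `^ (- s))%R else 0%R.

(** The dyadic argument run outwards: dilation by [2] gives the ratio [2^(n - s)], which is less
    than 1 because [s > n]. *)
Lemma integral_exterior n s : (n%:R < s)%R ->
  integral_Rn (fun x : 'rV[R]_n => (exterior n s x)%:E) < +oo.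
Proof.
move=> sn.
pose u k := integral_Rn (fun x : 'rV[R]_n => (annulus n s 1 (2 ^+ k) x)%:E).
pose A := integral_Rn (fun x : 'rV[R]_n => (annulus n s 1 2 x)%:E).
pose t : R := (2 `^ (n%:R - s))%R.
have h0 : (0 < 2 :> R)%R by [].
have h1 : (1 <= 2 :> R)%R by rewrite ler1n.
apply: (@le_lt_trans _ _ (fine A / (1 - t))%:E); last exact: ltry.
apply: (integral_Rn_le_limit _ (fun k => annulus n s 1 (2 ^+ k))).
- by move=> k x; exact: annulus_ge0.
- by move=> k; exact: measurable_annulus.
- by move=> x k l kl; apply: annulusS => //; rewrite ler_weXn2l.
- move=> x; near=> k; rewrite /annulus /exterior (_ : (enorm x <= 2 ^+ k)%R)
  ?andbT//.
  apply: (@le_trans _ _ (k%:R)).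
    by near: k; exact: nbhs_infty_ger.
  by rewrite -natrX ler_nat ltnW// ltn_expl.
- apply: (geometric_bound u) => //.
  + exact: powR_ge0.
  + rewrite /t -opprB powRN invf_lt1 ?powR_gt0//.
    rewrite [ltLHS](_ : _ = 1 `^ (s - n%:R))%R; last by rewrite powR1.
    by rewrite gt0_ltr_powR ?subr_gt0 ?nnegrE// ltr1n.
  + exact: integral_annulus_fin.
  + exact: integral_annulus_ge0.
  + by rewrite /u expr0 integral_annulus0.
  + move=> k; rewrite /u (integral_annulusD _ _ _ 2%R)//; last first.
      by rewrite exprS ler_peMr// exprn_ege1.
    congr (_ + _); rewrite /t -integral_annulus_scale//.
    by rewrite mulr1 exprS.
Unshelve. all: by end_near. Qed.

End RadialIntegrals.

(** * Riesz potentials *)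

Section RieszPotential.
Context {R : realType}.
Implicit Types beta H : R.

Lemma powRD_gt0 (z r s : R) : 0 < z -> z `^ (r + s) = z `^ r * z `^ s.
Proof. by move=> z0; rewrite powRD// (lt0r_neq0 z0) implybT. Qed.

Lemma powR_mulS (z s : R) : 0 < z -> z * z `^ s = z `^ (s + 1).
Proof. by move=> z0; rewrite powRD_gt0// powRr1 ?ltW// mulrC. Qed.

(* The zero cases, where a negative power of [0] is [0], are included in order to
   avoid almost-everywhere statements; [a = 0] forces [1 + beta] instead of
     [beta]. *)
Lemma kernel_lipschitz (a b d beta : R) : 0 < beta -> 0 <= a -> 0 <= b -> `|a -
  b| <= d ->
  b `^ (- beta) <= a `^ (- beta) +
    (1 + beta) * d * (a `^ (- (beta + 1)) + b `^ (- (beta + 1))).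
Proof.
move=> be0 a0 b0 abd.
have d0 : 0 <= d by exact: le_trans abd.
have rhs0 : 0 <= (1 + beta) * d * (a `^ (- (beta + 1)) + b `^ (- (beta + 1))).
  by rewrite mulr_ge0 ?addr_ge0 ?powR_ge0// mulr_ge0// addr_ge0// ltW.
have be0' : - beta != 0 by rewrite oppr_eq0 gt_eqF.
move: b0; rewrite le_eqVlt => /predU1P[b0|b0].
  rewrite -b0 in rhs0 *; rewrite powR0//; apply: addr_ge0 rhs0; exact: powR_ge0.
have bE : b `^ (- beta) = b * b `^ (- (beta + 1)).
  by rewrite powR_mulS//; congr (_ `^ _); ring.
have bdle : d * b `^ (- (beta + 1)) <= d * (a `^ (- (beta + 1)) + b `^ (- (beta
  + 1))).
  by rewrite ler_wpM2l// lerDr powR_ge0.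
have db0 : 0 <= d * b `^ (- (beta + 1)) by rewrite mulr_ge0// powR_ge0.
move: a0; rewrite le_eqVlt => /predU1P[a0|a0].
  move: abd bdle rhs0; rewrite -a0 sub0r normrN gtr0_norm// => bd bdle _.
  apply: (@le_trans _ _ (d * b `^ (- (beta + 1)))).
    by rewrite bE ler_wpM2r// powR_ge0.
  apply: ler_wpDl; first exact: powR_ge0.
  rewrite -mulrA mulrDl mul1r (le_trans bdle)// lerDl mulr_ge0 ?(ltW be0)//.
  exact: le_trans db0 bdle.
have [ab|ba] := leP a b.
  by rewrite (le_trans (ler_powRN _ _ _ a0 ab (ltW be0)))// lerDl.
(* For [b < a], [a^-beta] is bounded below by the tangent to the power function at [b], obtained
   from [exp z >= 1 + z] and [ln (a / b) <= (a - b) / b]. *)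
have aE : a `^ (- beta) = b `^ (- beta) * expR (- beta * (ln a - ln b)).
  rewrite /powR !gt_eqF// -expRD; congr expR; ring.
have lnle : ln a - ln b <= (a - b) / b.
  rewrite -ln_div ?posrE// (_ : a / b = 1 + (a - b) / b); last by field;
    rewrite gt_eqF.
  by apply: le_ln1Dx; rewrite (lt_le_trans (ltrN10 _))// divr_ge0 ?subr_ge0// ltW.
have abd' : a - b <= d by move: abd; rewrite gtr0_norm// subr_gt0.
have h1 : b `^ (- beta) * (1 - beta * ((a - b) / b)) <= a `^ (- beta).
  rewrite aE ler_wpM2l ?powR_ge0//.
  apply: le_trans (expR_ge1Dx _); rewrite lerD2l mulNr lerN2 ler_wpM2l// ltW//.
have h2 : b `^ (- beta) * ((a - b) / b) <= d * b `^ (- (beta + 1)).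
  rewrite bE (_ : _ * _ = (a - b) * b `^ (- (beta + 1))); last by field;
    rewrite gt_eqF.
  by rewrite ler_wpM2r// powR_ge0.
have h3 : beta * (b `^ (- beta) * ((a - b) / b)) <= beta * (d * b `^ (- (beta +
  1))).
  by rewrite ler_wpM2l// ltW.
have h4 : beta * (d * b `^ (- (beta + 1))) <= beta * (d * (a `^ (- (beta + 1))
  + b `^ (- (beta + 1)))).
  by rewrite ler_wpM2l// ltW.
have h5 : 0 <= d * (a `^ (- (beta + 1)) + b `^ (- (beta + 1))).
  exact: le_trans db0 bdle.
rewrite -mulrA mulrDl mul1r.
move: h1 h3 h4 h5; rewrite mulrBr mulr1 mulrCA; lra.
Qed.

(** The radius is proportional to the distance to the origin, so that powers of [|x|], though
    singular there, satisfy the inequality with a uniform constant. The property is stable under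
    products and nonnegative powers. *)
Definition harnack n (H : R) (g : 'rV[R]_n -> R) :=
  forall x y, enorm (y - x) <= enorm x / 2 -> g x <= H * g y /\ g y <= H * g x.

Lemma near_enorm n (x y : 'rV[R]_n) : enorm (y - x) <= enorm x / 2 ->
  enorm x / 2 <= enorm y <= 2 * enorm x.
Proof.
move=> yx.
have h1 := ler_enormD _ (y - x) x; rewrite subrK in h1.
have h2 := ler_enormD _ (x - y) y; rewrite subrK enorm_subC in h2.
have := enorm_ge0 _ x.
by move=> ?; apply/andP; split; lra.
Qed.

Lemma harnack_powR n H (g : 'rV[R]_n -> R) e : 0 <= H -> 0 <= e -> (forall x, 0
  <= g x) ->
  harnack n H g -> harnack n (H `^ e) (fun x => g x `^ e).
Proof.
move=> H0 e0 g0 Hg x y /Hg [h1 h2].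
by rewrite -!powRM//; split; apply: ge0_ler_powR => //; rewrite nnegrE ?mulr_ge0.
Qed.

Lemma harnack_enorm n s : 0 <= s ->
  harnack n (2 `^ s) (fun x : 'rV[R]_n => enorm x `^ (- s)).
Proof.
move=> s0 x y yx; have /andP[h1 h2] := near_enorm _ _ _ yx.
(* At [x = 0] the ball reduces to the origin, and only [1 <= 2^s] is needed. *)
have := enorm_ge0 _ x; rewrite le_eqVlt => /predU1P[x0|x0].
  have y0 : enorm y = 0.
    by apply/eqP; rewrite eq_le enorm_ge0 andbT; move: h2; rewrite -x0 mulr0.
  have H1 : 1 <= 2 `^ s by rewrite -[leLHS](powRr0 (2 : R)) ler_powR// ler1n.
  by rewrite y0 -x0; split; rewrite ler_peMl// powR_ge0.
have y0 : 0 < enorm y by rewrite (lt_le_trans _ h1)// divr_gt0.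
have e (z : R) : 0 < z -> 2 `^ s * z `^ (- s) = (z / 2) `^ (- s).
  move=> z0; rewrite powRM ?invr_ge0 ?ltW// mulrC; congr (_ * _).
  by rewrite -powR_inv1// -powRrM mulN1r opprK.
rewrite !e//; split.
  by apply: ler_powRN => //; [rewrite divr_gt0|rewrite ler_pdivrMr// mulrC].
by apply: ler_powRN => //; rewrite divr_gt0.
Qed.

Lemma harnackM n H1 H2 (g1 g2 : 'rV[R]_n -> R) : (forall x, 0 <= g1 x) ->
  (forall x, 0 <= g2 x) ->
  harnack n H1 g1 -> harnack n H2 g2 -> harnack n (H1 * H2) (fun x => g1 x * g2
    x).
Proof.
move=> g10 g20 h1 h2 x y yx; have [a b] := h1 _ _ yx; have [c d] := h2 _ _ yx.
by rewrite ![H1 * H2 * _]mulrACA; split; apply: ler_pM.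
Qed.

Lemma measurable_subrow n d (T : measurableType d) (f g : T -> 'rV[R]_n) :
  measurable_fun setT f -> measurable_fun setT g ->
  measurable_fun setT (fun x => f x - g x).
Proof.
move=> /measurable_fun_rowP mf /measurable_fun_rowP mg;
  apply/measurable_fun_rowP => i.
under eq_fun do rewrite !mxE.
exact: measurable_funB.
Qed.

Lemma measurable_enorm_powR n d (T : measurableType d) (f : T -> 'rV[R]_n) s :
  measurable_fun setT f -> measurable_fun setT (fun x => enorm (f x) `^ s).
Proof.
move=> mf; apply: (measurableT_comp (measurable_powR s)).
exact: measurableT_comp (@measurable_enorm R n) mf.
Qed.

Lemma measurable_kernel n beta (g : 'rV[R]_n -> R) (x : 'rV[R]_n) :
  measurable_fun setT g -> measurable_fun setT (fun y => (g y * enorm (x - y)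
    `^ (- beta))%:E).
Proof.
move=> mg; apply/measurable_EFinP; apply: measurable_funM => //.
by apply: measurable_enorm_powR; exact: measurable_subrow.
Qed.

Local Open Scope ereal_scope.

(** The unnormalized Riesz potential of order [n - beta]. Taking [beta = n - alpha] gives the
    operators of the system; [beta + 1] controls the variation of such a potential. *)
Definition potential n beta (g : 'rV[R]_n -> R) (x : 'rV[R]_n) : \bar R :=
  integral_Rn (fun y => (g y * enorm (x - y) `^ (- beta))%:E).

Lemma kernel_ge0 n beta (g : 'rV[R]_n -> R) x y : (forall x, 0 <= g x)%R ->
  0 <= (g y * enorm (x - y) `^ (- beta))%:E.
Proof. by move=> g0; rewrite lee_fin mulr_ge0// powR_ge0. Qed.

Lemma potential_ge0 n beta (g : 'rV[R]_n -> R) x : (forall x, 0 <= g x)%R ->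
  0 <= potential n beta g x.
Proof. by move=> g0; apply: integral_Rn_ge0 => y; exact: kernel_ge0. Qed.

(** The open cube with side [(0, 1/n)] avoids the origin and lies in the unit ball, since there
    [|x|^2 <= n (1/n)^2 <= 1]; hence [|x|^-beta >= 1] on it. *)
Lemma cube_le_annulus n beta (x : 'rV[R]_n) : (0 < n)%N -> (0 <= beta)%R ->
  (cube_fun n 0 (n%:R^-1) x <= annulus n beta 0 1 x)%R.
Proof.
move=> n0 be0.
have [inQ|/existsNP[i /negP xi]] := pselect (forall i, (0 < x ord0 i <
  n%:R^-1)%R); last first.
  rewrite /cube_fun (bigD1 i)//= indicE memNset ?mul0r ?annulus_ge0//=.
  by rewrite in_itv /=; exact/negP.
have xpos : (0 < enorm x)%R.
  have /andP[h _] := inQ (Ordinal n0).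
  by rewrite (lt_le_trans _ (normr_coord_le_enorm _ _ (Ordinal n0)))// gtr0_norm.
have nR : (0 < n%:R :> R)%R by rewrite ltr0n.
have x1 : (enorm x <= 1)%R.
  rewrite -(@ler_pXn2r _ 2) ?nnegrE ?enorm_ge0// expr1n.
  apply: (le_trans (enorm_sqr_le _ _ n%:R^-1 _)).
    by move=> i; have /andP[h1 h2] := inQ i; rewrite gtr0_norm// ltW.
  by rewrite expr2 mulrA divff ?gt_eqF// mul1r invf_le1// ler1n.
rewrite /annulus xpos x1 /= (@le_trans _ _ 1%R)//.
  rewrite /cube_fun prodr_ile1// => i _; rewrite indicE; case: (_ \in _) => /=;
  by rewrite ?lexx ?ler01.
have -> : 1%R = (1 `^ (- beta))%R :> R by rewrite powR1.
by rewrite ler_powRN.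
Qed.

Lemma integral_annulus_lower n beta : (0 < n)%N -> (0 <= beta)%R ->
  ((n%:R^-1) ^+ n)%:E <= integral_Rn (fun x : 'rV[R]_n => (annulus n beta 0 1
    x)%:E).
Proof.
move=> n0 be0; rewrite -[X in (X ^+ n)%R]subr0 -integral_cube ?invr_ge0//.
apply: le_integral_Rn.
- by move=> x; rewrite lee_fin cube_fun_ge0.
- by apply/measurable_EFinP; exact: measurable_cube_fun.
- exact: measurable_annulus_EFin.
- by move=> x; rewrite lee_fin cube_le_annulus.
Qed.

Lemma integral_annulus_ball n s (x : 'rV[R]_n) r : (0 < r)%R ->
  integral_Rn (fun y : 'rV[R]_n => (annulus n s 0 r (x - y))%:E) =
  (r `^ (n%:R - s))%:E * integral_Rn (fun y : 'rV[R]_n => (annulus n s 0 1 y)%:E).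
Proof.
move=> r0.
rewrite -integral_annulus_scale// mulr0 mulr1.
transitivity (integral_Rn (fun y : 'rV[R]_n => (annulus n s 0 r (y - x))%:E)).
  by apply: eq_integral_Rn => y; rewrite /annulus enorm_subC.
etransitivity.
  apply: (integral_Rn_affine n x 1) => //.
  - by move=> y; rewrite lee_fin annulus_ge0.
  - apply: (measurableT_comp (measurable_annulus_EFin n s 0 r)).
    exact: measurable_subrow.
rewrite expr1n mul1e; apply: eq_integral_Rn => y.
by rewrite scale1r addrC addKr.
Qed.

Lemma measurable_annulus_sub n s a b (x : 'rV[R]_n) :
  measurable_fun setT (fun y : 'rV[R]_n => (annulus n s a b (x - y))%:E).
Proof.
apply: (measurableT_comp (measurable_annulus_EFin n s a b)).
exact: measurable_subrow.
Qed.

(** Only the ball [|x - y| <= |x| / 2] is kept: there [g y >= g x / H], and the remaining integral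
    of the kernel scales like [|x|^(n - beta)]. *)
Lemma potential_lower n beta H : (0 < n)%N -> (0 <= beta)%R -> (0 < H)%R ->
  exists2 c : R, (0 < c)%R & forall g : 'rV[R]_n -> R,
    (forall x, 0 <= g x)%R -> measurable_fun setT g -> harnack n H g ->
    forall x, (0 < enorm x)%R ->
    (c * (g x * enorm x `^ (n%:R - beta)))%:E <= potential n beta g x.
Proof.
move=> n0 be0 H0.
(* The factors are the Harnack loss, the scaling of the radius [|x| / 2], and the lower bound for
   the kernel integral over the unit ball. *)
exists (H^-1 * (2 `^ (n%:R - beta))^-1 * (n%:R^-1) ^+ n)%R.
  by rewrite !mulr_gt0 ?invr_gt0 ?powR_gt0// exprn_gt0// invr_gt0 ltr0n.
move=> g g0 mg Hg x x0.
apply: (@le_trans _ _ (integral_Rn (fun y : 'rV[R]_n =>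
    (H^-1 * g x)%:E * (annulus n beta 0 (enorm x / 2) (x - y))%:E))); last first.
  apply: le_integral_Rn.
  - by move=> y; rewrite -EFinM lee_fin mulr_ge0 ?annulus_ge0// mulr_ge0//
    invr_ge0 ltW.
  - by apply: measurable_funeM; exact: measurable_annulus_sub.
  - exact: measurable_kernel.
  - move=> y; rewrite -EFinM lee_fin /annulus; case: ifP => [/andP[_ h]|_].
      rewrite ler_wpM2r ?powR_ge0// mulrC ler_pdivrMr// mulrC.
      by rewrite enorm_subC in h; have [] := Hg _ _ h.
    by rewrite mulr0 mulr_ge0// powR_ge0.
rewrite integral_RnZl; first last.
- exact: measurable_annulus_sub.
- by move=> y; rewrite lee_fin annulus_ge0.
- by rewrite lee_fin mulr_ge0// invr_ge0 ltW.
have r0 : (0 < enorm x / 2)%R by rewrite divr_gt0.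
rewrite integral_annulus_ball// muleA -EFinM.
apply: (@le_trans _ _ ((H^-1 * g x * (enorm x / 2) `^ (n%:R - beta))%:E *
  ((n%:R^-1) ^+ n)%:E)).
  rewrite -EFinM lee_fin powRM ?enorm_ge0 ?invr_ge0// -[(2^-1)%R]powR_inv1//.
  rewrite -powRrM mulN1r powRN.
  by rewrite le_eqVlt; apply/orP; left; apply/eqP; ring.
rewrite lee_wpmul2l ?integral_annulus_lower// lee_fin mulr_ge0 ?powR_ge0//
  mulr_ge0//.
by rewrite invr_ge0 ltW.
Qed.

(* Where [|x - y| > |x| / 2] the factor [|x| / |x - y|] is at most 2; elsewhere [g]
   is comparable to [g x], and the singularity of order [beta + 1 < n] is
   integrable. *)
Lemma potential_grad n beta H : (0 < n)%N -> (0 <= beta)%R -> (beta + 1 <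
  n%:R)%R -> (0 < H)%R ->
  exists2 C : R, (0 <= C)%R & forall g : 'rV[R]_n -> R,
    (forall x, 0 <= g x)%R -> measurable_fun setT g -> harnack n H g ->
    forall x, (0 < enorm x)%R ->
    (enorm x)%:E * potential n (beta + 1) g x <= C%:E * potential n beta g x.
Proof.
move=> n0 be0 ben H0.
have [c c0 cP] := potential_lower n beta H n0 be0 H0.
have := integral_annulus_near0 n (beta + 1)%R ben.
set A := integral_Rn _ => Aoo.
have A0 : 0 <= A := integral_annulus_ge0 _ _ _ _.
have Afin : A \is a fin_num by rewrite ge0_fin_numE.
(* [D] measures the contribution of the ball of radius [|x| / 2]. Dividing by the constant [c] of
   [potential_lower] turns it into a multiple of the potential; the [2] in the witness below is the
   far region. *)
pose D := (H * (2 `^ (n%:R - (beta + 1)))^-1 * fine A)%R.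
have D0 : (0 <= D)%R.
  by rewrite !mulr_ge0 ?fine_ge0 ?invr_ge0 ?powR_ge0// ltW.
exists (2 + D / c)%R; first by rewrite addr_ge0// divr_ge0// ltW.
move=> g g0 mg Hg x x0.
have xH0 : (0 <= enorm x * (H * g x))%R by rewrite !mulr_ge0// ltW.
rewrite /potential -integral_RnZl; first last.
- exact: measurable_kernel.
- by move=> y; exact: kernel_ge0.
- by rewrite lee_fin ltW.
apply: (@le_trans _ _ (integral_Rn (fun y : 'rV[R]_n =>
    2%:E * (g y * enorm (x - y) `^ (- beta))%:E +
    (enorm x * (H * g x))%:E * (annulus n (beta + 1) 0 (enorm x / 2) (x -
      y))%:E))).
  apply: le_integral_Rn.
  - by move=> y; rewrite -EFinM lee_fin mulr_ge0 ?enorm_ge0// mulr_ge0// powR_ge0.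
  - by apply: measurable_funeM; exact: measurable_kernel.
  - apply: emeasurable_funD; apply: measurable_funeM; first exact:
    measurable_kernel.
    exact: measurable_annulus_sub.
  - move=> y; rewrite -!EFinM -EFinD lee_fin /annulus.
    have := enorm_ge0 _ (x - y); rewrite le_eqVlt => /predU1P[xy0|xy0].
      have b1 : (- (beta + 1) != 0)%R by rewrite oppr_eq0 gt_eqF// ltr_wpDl.
      rewrite -xy0 ltxx /= (powR0 b1) !mulr0 addr0.
      by rewrite mulr_ge0// mulr_ge0// powR_ge0.
    rewrite xy0 /=.
    have eE : (enorm (x - y) `^ (- beta) = enorm (x - y) * enorm (x - y) `^ (-
      (beta + 1)))%R.
      rewrite powR_mulS//.
      by congr (_ `^ _)%R; ring.
    case: ifP => [h|/negbT]; last first.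
      rewrite -ltNge => h; rewrite mulr0 addr0 eE.
      rewrite [leLHS](_ : _ = g y * enorm (x - y) `^ (- (beta + 1)) * enorm
        x)%R; last by ring.
      rewrite [leRHS](_ : _ = g y * enorm (x - y) `^ (- (beta + 1)) * (2 *
        enorm (x - y)))%R; last by ring.
      rewrite ler_wpM2l ?mulr_ge0 ?powR_ge0//; lra.
    rewrite ler_wpDl//.
      by rewrite mulr_ge0// mulr_ge0// powR_ge0.
    rewrite -mulrA ler_wpM2l ?enorm_ge0// ler_wpM2r ?powR_ge0//.
    by rewrite enorm_subC in h; have [] := Hg _ _ h.
rewrite integral_RnD; first last.
- by apply: measurable_funeM; exact: measurable_annulus_sub.
- by apply: measurable_funeM; exact: measurable_kernel.
- by move=> y; rewrite -EFinM lee_fin mulr_ge0// annulus_ge0.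
- by move=> y; rewrite -EFinM lee_fin mulr_ge0// mulr_ge0// powR_ge0.
rewrite integral_RnZl//; first last.
- exact: measurable_kernel.
- by move=> y; exact: kernel_ge0.
rewrite integral_RnZl//; first last.
- exact: measurable_annulus_sub.
- by move=> y; rewrite lee_fin annulus_ge0.
have r0 : (0 < enorm x / 2)%R by rewrite divr_gt0.
rewrite integral_annulus_ball// -/A -(fineK Afin).
rewrite -/(potential n beta g x) [X in _ <= X * _]EFinD.
rewrite [leRHS]ge0_muleDl ?lee_fin ?divr_ge0 ?(ltW c0)//.
apply: leeD2l.
have <- : ((D / c)%:E * (c * (g x * enorm x `^ (n%:R - beta)))%:E =
    (enorm x * (H * g x))%:E * (((enorm x / 2) `^ (n%:R - (beta + 1)))%:E *
      (fine A)%:E)).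
  rewrite -!EFinM; congr EFin.
  have -> : (enorm x `^ (n%:R - beta) = enorm x * enorm x `^ (n%:R - (beta +
    1)))%R.
    rewrite powR_mulS//.
    by congr (_ `^ _)%R; ring.
  rewrite powRM ?enorm_ge0 ?invr_ge0// -[(2^-1)%R]powR_inv1// -powRrM mulN1r
    powRN /D.
  by field; rewrite gt_eqF//= gt_eqF// powR_gt0.
apply: lee_wpmul2l; first by rewrite lee_fin divr_ge0// ltW.
exact: cP.
Qed.

(** [kernel_lipschitz] integrated against [g], with [d = |x - x'|] by the reverse triangle
    inequality. The additive form avoids subtracting extended reals. *)
Lemma potential_diff n beta (g : 'rV[R]_n -> R) (x x' : 'rV[R]_n) :
  (0 < beta)%R -> (forall x, 0 <= g x)%R -> measurable_fun setT g ->
  potential n beta g x' <= potential n beta g x +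
   ((1 + beta) * enorm (x - x'))%:E *
     (potential n (beta + 1) g x + potential n (beta + 1) g x').
Proof.
move=> be0 g0 mg; rewrite /potential.
have k0 b z y : 0 <= (g y * enorm (z - y) `^ (- b))%:E by exact: kernel_ge0.
have mk b z : measurable_fun setT (fun y => (g y * enorm (z - y) `^ (- b))%:E).
  exact: measurable_kernel.
have c0 : 0 <= ((1 + beta) * enorm (x - x'))%:E.
  by rewrite lee_fin mulr_ge0 ?enorm_ge0// addr_ge0// ltW.
rewrite -(integral_RnD n _ _ (k0 _ _) (k0 _ _) (mk _ _) (mk _ _)).
have mkD : measurable_fun setT (fun y => (g y * enorm (x - y) `^ (- (beta +
  1)))%:E +
  (g y * enorm (x' - y) `^ (- (beta + 1)))%:E) by exact: emeasurable_funD.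
rewrite -integral_RnZl//; last by move=> y; exact: adde_ge0.
rewrite -integral_RnD//; first last.
- exact: measurable_funeM.
- by move=> y; rewrite mule_ge0// adde_ge0.
apply: le_integral_Rn => //.
  by apply: emeasurable_funD => //; exact: measurable_funeM.
move=> y; rewrite -[X in _ + _ * X]EFinD -EFinM -EFinD lee_fin.
have abd : (`|enorm (x - y) - enorm (x' - y)| <= enorm (x - x'))%R.
  have h1 := ler_enormD _ (x - x') (x' - y).
  have h2 := ler_enormD _ (x' - x) (x - y).
  rewrite !subrKA in h1 h2; rewrite [enorm (x' - x)]enorm_subC in h2.
  by rewrite ler_norml; apply/andP; split; lra.
have := kernel_lipschitz _ _ _ _ be0 (enorm_ge0 _ (x - y)) (enorm_ge0 _ (x' -
  y)) abd.
move=> /(ler_wpM2l (g0 y)) /le_trans; apply.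
by rewrite le_eqVlt; apply/orP; left; apply/eqP; ring.
Qed.

End RieszPotential.

(** * Dilations *)

Section Comparison.
Context {R : realType}.
Implicit Types beta H : R.

(** [exp (- x) >= 1 - x] gives [exp x <= 1 / (1 - x)], and [(1 + x + 2 x^2) (1 - x) - 1 = x^2 (1 - 2
    x) >= 0]. *)
Lemma expR_le_quadratic (x : R) : `|x| <= 2^-1 -> expR x <= 1 + x + 2 * x ^+ 2.
Proof.
rewrite ler_norml => /andP[h1 h2].
have h := expR_ge1Dx (- x).
have x1 : 0 < 1 - x by lra.
have : expR x <= (1 - x)^-1.
  by rewrite -[expR x]invrK lef_pV2 ?posrE ?invr_gt0 ?expR_gt0// -expRN.
move=> /le_trans; apply; rewrite -[leLHS]mul1r ler_pdivrMr//.
have := mulr_ge0 (sqr_ge0 x) (_ : 0 <= 1 - 2 * x); rewrite expr2.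
by move=> /(_ ltac:(lra)); lra.
Qed.

Lemma expR_ln_div (a b : R) : 0 < a -> 0 < b -> b = a * expR (ln (b / a)).
Proof.
by move=> a0 b0; rewrite lnK ?posrE ?divr_gt0// mulrC divfK// gt_eqF.
Qed.

Lemma powR_expR (a s r : R) : 0 < a -> (a * expR s) `^ r = a `^ r * expR (r * s).
Proof.
by move=> a0; rewrite powRM ?expR_ge0 ?ltW// -expRM mulrC [s * r]mulrC mulrC.
Qed.

(** Put [b = a exp s] and divide by [a^(q+1)]: the claim becomes [exp ((q+1) s) + q <= (q+1) exp s +
    2 ((q+1) s)^2], in which the terms of order 0 and 1 balance. *)
Lemma powR_taylor (a b q : R) : 0 < a -> 0 < b -> 0 < q ->
  (q + 1) * `|ln (b / a)| <= 2^-1 ->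
  b `^ (q + 1) + q * a `^ (q + 1) <=
  (q + 1) * (a `^ q * b) + 2 * ((q + 1) * ln (b / a)) ^+ 2 * a `^ (q + 1).
Proof.
move=> a0 b0 q0; set s := ln (b / a) => hs.
have bE : b = a * expR s by exact: expR_ln_div.
have -> : a `^ q * b = a `^ (q + 1) * expR s.
  by rewrite [in LHS]bE mulrA [_ * a]mulrC powR_mulS.
have -> : b `^ (q + 1) = a `^ (q + 1) * expR ((q + 1) * s).
  by rewrite [in LHS]bE powR_expR.
have P0 : 0 < a `^ (q + 1) by exact: powR_gt0.
have h1 : expR ((q + 1) * s) <= 1 + (q + 1) * s + 2 * ((q + 1) * s) ^+ 2.
  apply: expR_le_quadratic; rewrite normrM gtr0_norm//; lra.
have h2 : (q + 1) * (1 + s) <= (q + 1) * expR s.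
  by rewrite ler_wpM2l ?expR_ge1Dx//; lra.
rewrite [leLHS](_ : _ = a `^ (q + 1) * (expR ((q + 1) * s) + q)); last by ring.
rewrite [leRHS](_ : _ = a `^ (q + 1) * ((q + 1) * expR s + 2 * ((q + 1) * s) ^+
  2)); last by ring.
rewrite ler_pM2l//; lra.
Qed.

(** Put [b = a exp s] and divide by [b^p a]: the claim becomes [p + 1 <= p exp s + exp (- p s)],
    which is [exp z >= 1 + z] used twice. *)
Lemma powR_young (a b p : R) : 0 < a -> 0 < b -> 0 < p ->
  (p + 1) * (b `^ p * a) <= p * b `^ (p + 1) + a `^ (p + 1).
Proof.
move=> a0 b0 p0; set s := ln (b / a).
have bE : b = a * expR s by exact: expR_ln_div.
set Q := a `^ (p + 1) * expR (p * s).
have Q0 : 0 < Q by rewrite mulr_gt0 ?powR_gt0 ?expR_gt0.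
have -> : b `^ p * a = Q.
  by rewrite [in LHS]bE powR_expR// /Q -powR_mulS//; ring.
have -> : b `^ (p + 1) = Q * expR s.
  by rewrite [in LHS]bE powR_expR// mulrDl mul1r expRD mulrA.
have -> : a `^ (p + 1) = Q * expR (- (p * s)).
  by rewrite expRN mulfK// gt_eqF// expR_gt0.
have h1 : p * (1 + s) <= p * expR s by rewrite ler_wpM2l ?expR_ge1Dx// ltW.
have h2 := expR_ge1Dx (- (p * s)).
rewrite [leLHS]mulrC [leRHS](_ : _ = Q * (p * expR s + expR (- (p * s)))); last
  by ring.
rewrite ler_pM2l//; lra.
Qed.

(** Each hypothesis bounds a ratio by [(1 + t) / (1 - t)], which is at most [1 + 4 t] for
    [t <= 1/2]; then [ln (1 + z) <= z]. *)
Lemma ln_ratio_le (a b t : R) : 0 < a -> 0 < b -> 0 <= t -> t <= 2^-1 ->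
  b <= a + t * (a + b) -> a <= b + t * (a + b) -> `|ln (b / a)| <= 4 * t.
Proof.
move=> a0 b0 t0 t1.
have key (x y : R) : 0 < x -> 0 < y -> y <= x + t * (x + y) -> ln (y / x) <= 4
  * t.
  move=> x0 y0 h.
  have : y / x <= 1 + 4 * t.
    rewrite ler_pdivrMr// -(@ler_pM2l _ (1 - t)); last by lra.
    apply: (@le_trans _ _ (x * (1 + t))); first by lra.
    rewrite [leRHS](_ : _ = x * (1 + 3 * t - 4 * t * t)); last by ring.
    rewrite ler_pM2l//.
    have : t * t <= t * 2^-1 by rewrite ler_wpM2l.
    lra.
  move=> h2; apply: le_trans (le_ln1Dx _); last by lra.
  by rewrite ler_ln ?posrE ?divr_gt0//; lra.
move=> h1 h2; rewrite ler_norml key// andbT lerNl -lnV ?posrE ?divr_gt0//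
  invf_div.
by apply: key => //; rewrite [b + a]addrC.
Qed.

Local Open Scope ereal_scope.

(** [potential_diff] along a ray costs [(1 - l) |x|] times potentials of exponent [beta + 1], and
    [potential_grad] absorbs the factor [|x|]. The constants are chosen before [g], [v] and [x]. *)
Lemma log_lipschitz n beta H : (0 < n)%N -> (0 < beta)%R -> (beta + 1 < n%:R)%R
  -> (0 < H)%R ->
  exists K t0 : R, [/\ (0 <= K)%R, (0 < t0)%R &
  forall (g v : 'rV[R]_n -> R),
    (forall x, 0 <= g x)%R -> measurable_fun setT g -> harnack n H g ->
    (forall x, 0 < v x)%R -> (forall x, (v x)%:E = potential n beta g x) ->
    forall t x, (0 < t)%R -> (t <= t0)%R ->
      (`|ln (v (expR (- t) *: x) / v x)| <= K * t)%R].
Proof.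
move=> n0 be0 ben H0.
have [C C0 CP] := potential_grad n beta H n0 (ltW be0) ben H0.
(* The [2] pays for replacing [|x|] by [|l x|], as [l >= 1/2]. The [4] in the witness comes from
   [ln_ratio_le], and the bound on [t] gives both [t <= 1/2] and [t C' <= 1/2]. *)
pose C' := (2 * (1 + beta) * C)%R.
have C'0 : (0 <= C')%R by rewrite /C' !mulr_ge0//; lra.
exists (4 * C')%R, (2^-1 / (1 + C'))%R; split => //.
- by rewrite mulr_ge0.
- by rewrite divr_gt0//; lra.
move=> g v g0 mg Hg v0 vE t x t0.
rewrite ler_pdivlMr; last by lra.
rewrite mulrDr mulr1 => tle.
have tC0 : (0 <= t * C')%R by rewrite mulr_ge0// ltW.
set l := expR (- t).
have l0 : (0 < l)%R by exact: expR_gt0.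
have l1 : (l <= 1)%R by rewrite expR_le1; lra.
have lt : (1 - l <= t)%R by have := expR_ge1Dx (- t); rewrite -/l; lra.
have lh : (2^-1 <= l)%R by lra.
have := enorm_ge0 _ x; rewrite le_eqVlt => /predU1P[/esym/eqP|x0].
  rewrite enorm_eq0 => /eqP ->.
  rewrite scaler0 divff; last by rewrite gt_eqF.
  by rewrite ln1 normr0; apply: mulr_ge0 (ltW t0); exact: mulr_ge0.
have x'0 : (0 < enorm (l *: x))%R by rewrite enormZ mulr_gt0// normr_gt0 gt_eqF.
have dE : enorm (x - l *: x) = ((1 - l) * enorm x)%R.
  by rewrite -[X in (X - _)%R]scale1r -scalerBl enormZ ger0_norm// subr_ge0.
have I0 z : 0 <= potential n (beta + 1) g z by exact: potential_ge0.
have b1 : (0 <= 1 + beta)%R by lra.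
have S : ((1 + beta) * enorm (x - l *: x))%:E *
    (potential n (beta + 1) g x + potential n (beta + 1) g (l *: x)) <=
    (t * C' * (v x + v (l *: x)))%:E.
  rewrite dE mulrA EFinM -muleA ge0_muleDr//.
  apply: (@le_trans _ _ (((1 + beta) * (1 - l))%:E * ((C * v x)%:E + (2 * C * v
    (l *: x))%:E))).
    apply: lee_wpmul2l; first by rewrite lee_fin mulr_ge0//; lra.
    apply: leeD.
      by rewrite EFinM vE; exact: CP.
    apply: (@le_trans _ _ (2%:E * ((enorm (l *: x))%:E * potential n (beta + 1)
      g (l *: x)))).
      rewrite muleA -EFinM; apply: lee_wpmul2r => //; rewrite lee_fin enormZ
        gtr0_norm// mulrA.
      by rewrite ler_peMl ?enorm_ge0//; lra.
    rewrite -mulrA EFinM; apply: lee_wpmul2l => //.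
    by rewrite EFinM vE; exact: CP.
  rewrite -EFinD -EFinM lee_fin.
  apply: (@le_trans _ _ ((1 + beta) * t * (2 * C * (v x + v (l *: x))))%R);
    last first.
    by rewrite le_eqVlt; apply/orP; left; apply/eqP; rewrite /C'; ring.
  apply: ler_pM.
  - by rewrite mulr_ge0//; lra.
  - by rewrite addr_ge0// !mulr_ge0// ltW.
  - by rewrite ler_wpM2l.
  - rewrite mulrDr lerD2r ler_wpM2r ?(ltW (v0 _))//; lra.
have h1 := potential_diff n beta g x (l *: x) be0 g0 mg.
have h2 := potential_diff n beta g (l *: x) x be0 g0 mg.
rewrite enorm_subC [X in _ * X]addeC in h2.
rewrite [leRHS](_ : _ = 4 * (t * C'))%R; last by ring.
apply: ln_ratio_le => //.
- lra.
- rewrite -lee_fin EFinD vE (le_trans h1)// -vE; exact: leeD2l.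
- rewrite -lee_fin EFinD vE (le_trans h2)// -vE; exact: leeD2l.
Qed.

Lemma measurable_scale_comp n (f : 'rV[R]_n -> R) (l : R) :
  measurable_fun setT f -> measurable_fun setT (fun x : 'rV[R]_n => f (l *: x)%R).
Proof.
move=> mf; apply: measurableT_comp mf _.
have := measurable_affine_row n (0 : 'rV[R]_n)%R l.
by under eq_fun do rewrite add0r.
Qed.

Lemma integral_Rn_scale n (f : 'rV[R]_n -> R) (l : R) : (0 < l)%R ->
  (forall x, 0 <= f x)%R -> measurable_fun setT f ->
  integral_Rn (fun x => (f (l *: x))%:E) = (l `^ (- n%:R))%:E * integral_Rn
    (fun x => (f x)%:E).
Proof.
move=> l0 f0 mf.
have mE : measurable_fun setT (fun x => (f x)%:E) by exact/measurable_EFinP.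
have E0 x : 0 <= (f x)%:E by rewrite lee_fin.
rewrite (integral_Rn_affine n 0 l (fun x => (f x)%:E) l0 E0 mE).
rewrite muleA -EFinM powRN powR_mulrn ?(ltW l0)// mulVf ?mul1e; last first.
  by rewrite gt_eqF// exprn_gt0.
by apply: eq_integral_Rn => x; rewrite add0r.
Qed.

(** Write [v (l x)] as an integral, substitute [l y] for [y] using the homogeneity of the kernel,
    then apply Tonelli and the symmetry of the kernel. *)
Lemma energy_exchange n beta (l : R) (f g u v : 'rV[R]_n -> R) : (0 < l)%R ->
  (forall x, 0 <= f x)%R -> (forall x, 0 <= g x)%R ->
  measurable_fun setT f -> measurable_fun setT g ->
  (forall x, (u x)%:E = potential n beta f x) ->
  (forall x, (v x)%:E = potential n beta g x) ->
  integral_Rn (fun x => (f x * v (l *: x))%:E) =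
  (l `^ (n%:R - beta))%:E * integral_Rn (fun y => (g (l *: y) * u y)%:E).
Proof.
move=> l0 f0 g0 mf mg uE vE.
pose F (x y : 'rV[R]_n) := (f x * (g (l *: y) * enorm (x - y) `^ (- beta)))%:E.
have F0 x y : 0 <= F x y by rewrite lee_fin !mulr_ge0// powR_ge0.
have mgl := measurable_scale_comp _ _ l mg.
have mF : measurable_fun setT (fun z => F z.1 z.2).
  apply/measurable_EFinP; apply: measurable_funM; first exact: measurableT_comp
    mf _.
  apply: measurable_funM; first exact: measurableT_comp mgl _.
  by apply: measurable_enorm_powR; exact: measurable_subrow.
have mFx x : measurable_fun setT (fun y : 'rV[R]_n => (g (l *: y) * enorm (x -
  y) `^ (- beta))%:E).
  apply/measurable_EFinP; apply: measurable_funM => //.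
  by apply: measurable_enorm_powR; exact: measurable_subrow.
have vl x : (v (l *: x))%:E = (l `^ (n%:R - beta))%:E *
    integral_Rn (fun y => (g (l *: y) * enorm (x - y) `^ (- beta))%:E).
  rewrite vE /potential powRD_gt0// powR_mulrn ?(ltW l0)//.
  etransitivity.
    apply: (integral_Rn_affine n 0 l) => //.
    - by move=> y; exact: kernel_ge0.
    - exact: measurable_kernel.
  rewrite EFinM -muleA; congr (_ * _).
  rewrite -[RHS]integral_RnZl//; first last.
  - by move=> y; rewrite lee_fin mulr_ge0// powR_ge0.
  - by rewrite lee_fin powR_ge0.
  apply: eq_integral_Rn => y.
  rewrite add0r -scalerBr enormZ gtr0_norm// powRM ?enorm_ge0 ?(ltW l0)// -EFinM.
  by congr EFin; rewrite mulrCA.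
have l'0 : 0 <= (l `^ (n%:R - beta))%:E by rewrite lee_fin powR_ge0.
transitivity (integral_Rn (fun x => (l `^ (n%:R - beta))%:E * integral_Rn (F x))).
  apply: eq_integral_Rn => x; rewrite EFinM vl muleCA; congr (_ * _).
  rewrite -integral_RnZl//; last by move=> y; rewrite lee_fin mulr_ge0// powR_ge0.
  by rewrite lee_fin.
rewrite integral_RnZl//; first last.
- exact: (measurable_integral_Rn n _ _ F).
- by move=> x; exact: integral_Rn_ge0.
congr (_ * _); rewrite integral_Rn_swap//; apply: eq_integral_Rn => y.
transitivity (integral_Rn (fun x =>
    (g (l *: y))%:E * (f x * enorm (y - x) `^ (- beta))%:E)).
  apply: eq_integral_Rn => x; rewrite /F -EFinM enorm_subC; congr EFin.
  by rewrite mulrCA.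
rewrite [RHS]EFinM uE; apply: integral_RnZl.
- by rewrite lee_fin.
- by move=> x; exact: kernel_ge0.
- exact: measurable_kernel.
Qed.

(** In the unit ball, boundedness leaves [|x|^-s] with [s < n]; outside it, the decay leaves
    [|x|^-(e theta + s)], whose exponent is beyond [n]. *)
Lemma energy_fin n (v : 'rV[R]_n -> R) (e s theta M C : R) :
  (0 <= e)%R -> (s < n%:R)%R -> (0 <= s)%R -> (n%:R < e * theta + s)%R ->
  measurable_fun setT v ->
  (forall x, 0 < v x)%R -> (forall x, v x <= M)%R -> (0 <= C)%R ->
  (forall x, 0 < enorm x -> v x <= C * enorm x `^ (- theta))%R ->
  integral_Rn (fun x => (v x `^ e * enorm x `^ (- s))%:E) < +oo.
Proof.
move=> e0 sn s0 es mv v0 vM C0 vC.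
have M0 : (0 <= M)%R by rewrite (le_trans (ltW (v0 0%R)) (vM _)).
(* The cube accounts for [x = 0] when [s = 0]: there [enorm x `^ (- s)] is [1]. *)
pose B1 x := (M `^ e)%:E * ((annulus n s 0 1 x)%:E + (cube_fun n (- 2) 2 x)%:E).
pose B2 x := (C `^ e)%:E * (exterior n (e * theta + s) x)%:E.
have mc : measurable_fun setT (fun x : 'rV[R]_n => (cube_fun n (- 2) 2 x)%:E).
  by apply/measurable_EFinP; exact: measurable_cube_fun.
have ma := measurable_annulus_EFin n s 0 1.
have mx : measurable_fun setT (fun x : 'rV[R]_n => (exterior n (e * theta + s)
  x)%:E).
  apply/measurable_EFinP; apply: measurable_fun_ifT => //.
    by apply: measurable_fun_ltr => //; exact: measurable_enorm.
  exact: measurable_enorm_powR.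
have ex0 (x : 'rV[R]_n) : (0 <= exterior n (e * theta + s) x)%R.
  by rewrite /exterior; case: ifP => // _; exact: powR_ge0.
have mB1 : measurable_fun setT B1 by apply: measurable_funeM; exact:
  emeasurable_funD.
have mB2 : measurable_fun setT B2 by exact: measurable_funeM.
have B10 x : 0 <= B1 x.
  apply: mule_ge0; first by rewrite lee_fin powR_ge0.
  by rewrite -EFinD lee_fin addr_ge0 ?annulus_ge0 ?cube_fun_ge0.
have B20 x : 0 <= B2 x by rewrite mule_ge0 ?lee_fin ?powR_ge0.
apply: (@le_lt_trans _ _ (integral_Rn (fun x => B1 x + B2 x))).
  apply: le_integral_Rn.
  - by move=> x; rewrite lee_fin mulr_ge0 ?powR_ge0.
  - apply/measurable_EFinP; apply: measurable_funM.
      exact: (measurableT_comp (measurable_powR e) mv).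
    exact: measurable_enorm_powR.
  - exact: emeasurable_funD.
  - move=> x; have [x1|x1] := leP (enorm x) 1%R.
      apply: (@le_trans _ _ (B1 x)); last exact: leeDl.
      rewrite /B1 -EFinD -EFinM lee_fin; apply: ler_pM; rewrite ?powR_ge0//.
        by rewrite ge0_ler_powR// nnegrE// ltW.
      rewrite cube_fun_1; last by lra.
      have := enorm_ge0 _ x; rewrite le_eqVlt => /predU1P[xe|xe].
        rewrite ler_wpDl ?annulus_ge0// -xe.
        have [->|ns0] := eqVneq (- s)%R 0%R; first by rewrite powRr0.
        by rewrite powR0// ler01.
      by rewrite /annulus xe x1 /= lerDl.
    apply: (@le_trans _ _ (B2 x)); last exact: leeDr.
    have xe : (0 < enorm x)%R by lra.
    rewrite /B2 -EFinM lee_fin /exterior x1 opprD powRD_gt0// mulrA.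
    rewrite ler_wpM2r ?powR_ge0// (_ : - (e * theta) = - theta * e)%R; last by
      ring.
    rewrite powRrM -powRM ?powR_ge0//.
    by rewrite ge0_ler_powR// ?nnegrE ?mulr_ge0 ?powR_ge0 ?vC// ltW.
rewrite integral_RnD// /B1 /B2 !integral_RnZl//; first last.
all: try exact: emeasurable_funD.
all: try by move=> x; rewrite -EFinD lee_fin addr_ge0 ?annulus_ge0 ?cube_fun_ge0.
all: try by rewrite lee_fin powR_ge0.
rewrite integral_RnD//; [|by move=> x; rewrite lee_fin annulus_ge0|by move=> x;
  rewrite lee_fin cube_fun_ge0].
rewrite integral_cube; last by lra.
have := integral_annulus_near0 n s sn; have := integral_annulus_ge0 n s 0 1.
have := integral_exterior n _ es.
have : 0 <= integral_Rn (fun x : 'rV[R]_n => (exterior n (e * theta + s) x)%:E).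
  by apply: integral_Rn_ge0.
case: (integral_Rn _) => // b _ _; case: (integral_Rn _) => // a _ _.
exact: ltry.
Qed.

Lemma energy_gt0 n (v : 'rV[R]_n -> R) (e s m : R) :
  (0 < n)%N -> (0 <= e)%R -> (0 <= s)%R -> measurable_fun setT v ->
  (forall x, 0 < v x)%R -> (0 < m)%R -> (forall x, enorm x <= 1 -> m <= v x)%R ->
  0 < integral_Rn (fun x => (v x `^ e * enorm x `^ (- s))%:E).
Proof.
move=> n0 e0 s0 mv v0 m0 vm.
apply: (@lt_le_trans _ _ (integral_Rn (fun x => (m `^ e)%:E * (annulus n s 0 1
  x)%:E))).
  rewrite integral_RnZl; first last.
  - exact: measurable_annulus_EFin.
  - by move=> x; rewrite lee_fin annulus_ge0.
  - by rewrite lee_fin powR_ge0.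
  rewrite mule_gt0 ?lte_fin ?powR_gt0//.
  apply: lt_le_trans (integral_annulus_lower n s n0 s0).
  by rewrite lte_fin exprn_gt0// invr_gt0 ltr0n.
apply: le_integral_Rn.
- by move=> x; rewrite -EFinM lee_fin mulr_ge0 ?powR_ge0 ?annulus_ge0.
- by apply: measurable_funeM; exact: measurable_annulus_EFin.
- apply/measurable_EFinP; apply: measurable_funM.
    exact: (measurableT_comp (measurable_powR e) mv).
  exact: measurable_enorm_powR.
- move=> x; rewrite -EFinM lee_fin /annulus; case: ifP => [/andP[_ x1]|_].
    rewrite ler_wpM2r ?powR_ge0// ge0_ler_powR// ?nnegrE ?vm// ltW//.
  by rewrite mulr0 mulr_ge0 ?powR_ge0.
Qed.

End Comparison.

(** * Nonexistence *)

Section Nonexistence.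
Context {R : realType}.

(** The minimum is taken over the closed cube of half-side [r], which is compact as a product of
    segments and contains the ball. *)
Lemma continuous_pos_lower_bound n (u : 'rV[R]_n -> R) (r : R) :
  0 <= r -> continuous u -> (forall x, 0 < u x) ->
  exists2 m : R, 0 < m & forall x, enorm x <= r -> m <= u x.
Proof.
move=> r0 cu u0.
have cA : compact [set x : 'rV[R]_n | forall i, `[- r, r]%classic (x ord0 i)].
  by apply: (@rV_compact _ _ (fun=> `[- r, r]%classic)) => _; exact:
    segment_compact.
have A0 : [set x : 'rV[R]_n | forall i, `[- r, r]%classic (x ord0 i)] !=set0.
  by exists 0 => i /=; rewrite mxE in_itv /= lerNl oppr0 r0.
have [c _ cmin] := compact_EVT_min A0 cA (continuous_subspaceT cu).
exists (u c) => // x xr; apply: cmin; rewrite inE => i /=.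
by rewrite in_itv /= -ler_norml (le_trans (normr_coord_le_enorm _ _ _)).
Qed.

(** Far out, the two-sided decay transfers the inequality from [|x|^-theta]; on a bounded region [u]
    stays between two positive constants. *)
Lemma harnack_of_decay n (u : 'rV[R]_n -> R) (M theta : R) :
  continuous u -> (forall x, 0 < u x) -> (forall x, u x <= M) -> 0 < theta ->
  simeq_pow u theta -> exists2 H : R, 0 < H & harnack n H u.
Proof.
move=> cu u0 uM th0 [c [C [R0 [c0 [C0 uC]]]]].
pose r := Num.max R0 1.
have r0 : 0 < r by rewrite /r lt_max ltr01 orbT.
have Rr : R0 <= r by rewrite /r le_max lexx.
(* If [|x| >= 2 r] then [|y| >= r >= R0]; otherwise [|y| <= 2 |x| < 4 r]. Hence the radius [4 r]. *)
have [m m0 um] := continuous_pos_lower_bound n u (4 * r) (mulr_ge0 (ler0n _ 4)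
  (ltW r0)) cu u0.
have M0 : 0 < M := lt_le_trans (u0 0) (uM 0).
pose H1 := C * 2 `^ theta / c.
have H10 : 0 <= H1 by rewrite divr_ge0 ?mulr_ge0 ?powR_ge0// ltW.
have H20 : 0 < M / m by rewrite divr_gt0.
exists (H1 + M / m); first by rewrite ltr_wpDl.
move=> x y yx; have /andP[h1 h2] := near_enorm _ _ _ yx.
have [xr|xr] := leP (2 * r) (enorm x).
  have [e1 e2] := harnack_enorm n theta (ltW th0) x y yx.
  have /uC/andP[ux1 ux2] : R0 <= enorm x by lra.
  have /uC/andP[uy1 uy2] : R0 <= enorm y by lra.
  have key (a b X Y : R) : 0 < b -> a <= C * X -> X <= 2 `^ theta * Y -> c * Y
    <= b ->
      a <= (H1 + M / m) * b.
    move=> b0 aX XY Yb; apply: (le_trans aX).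
    apply: (@le_trans _ _ (H1 * b)); last by rewrite ler_wpM2r ?(ltW b0)//
      lerDl ltW.
    apply: (@le_trans _ _ (C * (2 `^ theta * Y))); first by rewrite ler_wpM2l//
      ltW.
    rewrite /H1 -!mulrA ler_wpM2l ?(ltW C0)// ler_wpM2l ?powR_ge0//.
    by rewrite mulrC ler_pdivlMr// mulrC.
  by split; [exact: key e1 uy1|exact: key e2 ux1].
have mx : m <= u x by apply: um; lra.
have my : m <= u y by apply: um; lra.
have key (a b : R) : a <= M -> m <= b -> a <= (H1 + M / m) * b.
  move=> aM mb; apply: (le_trans aM).
  apply: (@le_trans _ _ ((M / m) * b)).
    by rewrite mulrAC ler_pdivlMr// ler_wpM2l// ltW.
  by rewrite ler_wpM2r ?lerDr// (le_trans _ mb)// ltW.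
by split; apply: key.
Qed.

(** The identity is pointwise without exception: [powRN] also holds at base 0, where the inverse of
    0 is 0. *)
Lemma riesz_opE n (alpha sigma e : R) (w : 'rV[R]_n -> R) x :
  riesz_op alpha sigma e w x =
  potential n (n%:R - alpha) (fun y => w y `^ e * enorm y `^ (- sigma)) x.
Proof.
by apply: eq_integral_Rn => y; congr EFin; rewrite !powRN invfM mulrA mulrAC.
Qed.

(** Both sides equal [q + 1] at [t = 0], so the inequality for small [t > 0] passes to the
    first-order coefficients. *)
Lemma first_order_comparison (N P S p q C t0 : R) : 0 < p -> 0 < q -> 0 <= C ->
  0 < t0 ->
  (forall t, 0 < t -> t <= t0 ->
    expR (N * t) + q <=
    (q + 1) / (p + 1) * (p * expR (P * t) + expR (S * t)) + C * t ^+ 2) ->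
  N <= (q + 1) / (p + 1) * (p * P + S).
Proof.
move=> p0 q0 C0 t00 Ht; rewrite leNgt; apply/negP => lt.
pose k := (q + 1) / (p + 1).
have k0 : 0 < k by rewrite divr_gt0// addr_gt0.
have kp : k * (p + 1) = q + 1 by rewrite divfK// gt_eqF// addr_gt0.
pose D := C + k * (2 * (p * P ^+ 2 + S ^+ 2)).
have D0 : 0 <= D.
  by rewrite addr_ge0// mulr_ge0 ?(ltW k0)// mulr_ge0// addr_ge0 ?sqr_ge0//
    mulr_ge0 ?sqr_ge0// ltW.
pose d := N - k * (p * P + S).
have d0 : 0 < d by rewrite subr_gt0.
(* [t1] keeps [P t] and [S t] within the range of [expR_le_quadratic]; [t2] makes the quadratic
   remainder [D t] at most half the gap [d], a contradiction. *)
pose t1 := (2 * (1 + `|P| + `|S|))^-1.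
have nP := normr_ge0 P; have nS := normr_ge0 S.
have t10 : 0 < t1 by rewrite invr_gt0; lra.
pose t2 := d / (2 * (D + 1)).
have t20 : 0 < t2 by rewrite divr_gt0//; lra.
pose t := Num.min t0 (Num.min t1 t2).
have tp : 0 < t by rewrite !lt_min t00 t10.
have tt0 : t <= t0 by rewrite ge_min lexx.
have tt1 : t <= t1 by rewrite !ge_min lexx orbT.
have tt2 : t <= t2 by rewrite !ge_min lexx !orbT.
have t1E : t1 * (1 + `|P| + `|S|) = 2^-1 by rewrite /t1; field; lra.
have small (z : R) : `|z| <= 1 + `|P| + `|S| -> `|z * t| <= 2^-1.
  move=> hz; rewrite normrM (gtr0_norm tp) -t1E mulrC.
  by apply: ler_pM => //; exact: ltW.
have hP := expR_le_quadratic _ (small P ltac:(lra)).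
have hS := expR_le_quadratic _ (small S ltac:(lra)).
have hN := expR_ge1Dx (N * t).
have {}Ht := Ht t tp tt0; rewrite -/k in Ht.
have h1 : k * (p * expR (P * t) + expR (S * t)) <=
    k * (p * (1 + P * t + 2 * (P * t) ^+ 2) + (1 + S * t + 2 * (S * t) ^+ 2)).
  by rewrite ler_wpM2l ?(ltW k0)// lerD// ler_wpM2l// ltW.
have h2 : k * (p * (1 + P * t + 2 * (P * t) ^+ 2) + (1 + S * t + 2 * (S * t) ^+
  2)) + C * t ^+ 2 =
    k * (p + 1) + k * (p * P + S) * t + D * t ^+ 2 by rewrite /D; ring.
have h3 : d * t <= D * t ^+ 2.
  by move: h2; rewrite kp /d mulrBl => h2; lra.
have h4 : d <= D * t by move: h3; rewrite expr2 mulrA ler_pM2r.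
have h5 : D * t <= D * t2 by rewrite ler_wpM2l.
have h6 : t2 * (2 * (D + 1)) = d by rewrite /t2 divfK// gt_eqF//; lra.
have h7 : t2 * D <= d / 2.
  have -> : d / 2 = t2 * D + t2 by rewrite -h6; field.
  lra.
by move: h4 h5 h7; rewrite [D * t2]mulrC; lra.
Qed.

(** Inserting the lower bound for [u] into that for [v] gives [v >= c v^(p q) |x|^w]. Since
    [p q > 1], dividing by [v] makes this an upper bound for [v]. *)
Lemma decay_bootstrap n (u v : 'rV[R]_n -> R) (p q alpha s1 s2 c1 c2 : R) :
  0 < p -> 0 < q -> 1 < p * q -> 0 < c1 -> 0 < c2 ->
  (forall x, 0 < u x) -> (forall x, 0 < v x) ->
  (forall x, 0 < enorm x -> c1 * (v x `^ q * enorm x `^ (- s1) * enorm x `^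
    alpha) <= u x) ->
  (forall x, 0 < enorm x -> c2 * (u x `^ p * enorm x `^ (- s2) * enorm x `^
    alpha) <= v x) ->
  exists2 C : R, 0 <= C & forall x, 0 < enorm x ->
    v x <= C * enorm x `^ (- ((p * (alpha - s1) + (alpha - s2)) / (p * q - 1))).
Proof.
move=> p0 q0 pq c10 c20 u0 v0 hu hv.
set w := p * (alpha - s1) + (alpha - s2).
pose kap := (c2 * c1 `^ p)^-1.
have kap0 : 0 < kap by rewrite invr_gt0 mulr_gt0// powR_gt0.
have pq0 : 0 < p * q - 1 by lra.
exists (kap `^ (p * q - 1)^-1); first exact: powR_ge0.
move=> x x0; set X := enorm x in x0 *.
have h1 : (c1 * (v x `^ q * X `^ (- s1) * X `^ alpha)) `^ p <= u x `^ p.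
  by rewrite ge0_ler_powR ?(ltW p0)// ?nnegrE ?hu// ?mulr_ge0 ?powR_ge0// ltW.
have h2 : c2 * c1 `^ p * (v x `^ (p * q) * X `^ w) <= v x.
  apply: le_trans (hv x x0); rewrite -/X -!mulrA ler_wpM2l ?(ltW c20)//.
  have -> : c1 `^ p * (v x `^ (p * q) * X `^ w) =
    (c1 * (v x `^ q * X `^ (- s1) * X `^ alpha)) `^ p * (X `^ (- s2) * X `^
      alpha).
    rewrite -mulrA -!powRD_gt0// !powRM ?powR_ge0 ?mulr_ge0 ?powR_ge0 ?(ltW
      c10)//.
    rewrite -!powRrM -!mulrA -powRD_gt0// [q * p]mulrC; congr (_ * (_ * _ `^ _)).
    by rewrite /w; ring.
  by rewrite ler_wpM2r// mulr_ge0 ?powR_ge0.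
have K0 : 0 < c2 * c1 `^ p by rewrite mulr_gt0// powR_gt0.
have h3 : v x `^ (p * q - 1) <= kap * X `^ (- w).
  have vE : v x * v x `^ (p * q - 1) = v x `^ (p * q) by rewrite powR_mulS//
    subrK.
  have h4 : v x * (v x `^ (p * q - 1) * X `^ w * (c2 * c1 `^ p)) <= v x * 1.
    rewrite mulr1 (_ : _ * (_ * _) = c2 * c1 `^ p * (v x `^ (p * q) * X `^ w))//.
    by rewrite -vE; ring.
  rewrite ler_pM2l in h4; last exact: v0.
  rewrite powRN ler_pdivlMr; last exact: powR_gt0.
  by rewrite /kap -[leRHS]mul1r ler_pdivlMr.
have -> : v x = (v x `^ (p * q - 1)) `^ (p * q - 1)^-1.
  by rewrite -powRrM divff ?gt_eqF// powRr1// ltW.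
have -> : X `^ (- (w / (p * q - 1))) = (X `^ (- w)) `^ (p * q - 1)^-1.
  by rewrite -powRrM mulNr.
rewrite -powRM ?(ltW kap0) ?powR_ge0//.
apply: ge0_ler_powR; rewrite ?nnegrE ?powR_ge0 ?invr_ge0 ?(ltW pq0)//.
by rewrite mulr_ge0 ?powR_ge0// (ltW kap0).
Qed.

Local Open Scope ereal_scope.

Lemma integral_Rn_lin2 n (a b : 'rV[R]_n -> R) (x y : R) :
  (0 <= x)%R -> (0 <= y)%R -> (forall z, 0 <= a z)%R -> (forall z, 0 <= b z)%R ->
  measurable_fun setT a -> measurable_fun setT b ->
  integral_Rn (fun z => (x * a z + y * b z)%:E) =
  x%:E * integral_Rn (fun z => (a z)%:E) + y%:E * integral_Rn (fun z => (b z)%:E).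
Proof.
move=> x0 y0 a0 b0 /measurable_EFinP ma /measurable_EFinP mb.
rewrite -!integral_RnZl//; try by move=> z; rewrite lee_fin.
rewrite -integral_RnD//.
- by move=> z; rewrite mule_ge0// lee_fin.
- by move=> z; rewrite mule_ge0// lee_fin.
- exact: measurable_funeM.
- exact: measurable_funeM.
Qed.

Lemma measurable_weight n (w : 'rV[R]_n -> R) (e s : R) : measurable_fun setT w ->
  measurable_fun setT (fun x => w x `^ e * enorm x `^ s)%R.
Proof.
move=> mw; apply: measurable_funM; last exact: measurable_enorm_powR.
exact: (measurableT_comp (measurable_powR e) mw).
Qed.

Lemma dilation_inequality n (p q alpha s1 s2 K t E : R) (u v : 'rV[R]_n -> R) :
  (0 < p)%R -> (0 < q)%R -> (0 < t)%R -> (0 < E)%R -> (0 <= K)%R ->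
  measurable_fun setT u -> measurable_fun setT v ->
  (forall x, 0 < u x)%R -> (forall x, 0 < v x)%R ->
  (forall x, (u x)%:E = potential n (n%:R - alpha) (fun y => v y `^ q * enorm y
    `^ (- s1))%R x) ->
  (forall x, (v x)%:E = potential n (n%:R - alpha) (fun y => u y `^ p * enorm y
    `^ (- s2))%R x) ->
  integral_Rn (fun x => (v x `^ (q + 1) * enorm x `^ (- s1))%:E) = E%:E ->
  (forall x, `|ln (v (expR (- t) *: x) / v x)| <= K * t)%R ->
  ((q + 1) * (K * t) <= 2^-1)%R ->
  (expR ((n%:R - s1) * t) + q <=
    (q + 1) / (p + 1) * (p * expR ((n%:R - alpha) * t) + expR ((s2 - alpha) *
      t)) +
    2 * ((q + 1) * K) ^+ 2 * t ^+ 2)%R.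
Proof.
move=> p0 q0 t0 E0 K0 mu mv u0 v0 uE vE hE lip small.
set l := expR (- t).
have l0 : (0 < l)%R by exact: expR_gt0.
have lpow (r : R) : (l `^ r = expR (- r * t))%R by rewrite -expRM; congr expR;
  ring.
pose f x := (v x `^ q * enorm x `^ (- s1))%R.
pose g x := (u x `^ p * enorm x `^ (- s2))%R.
pose h x := (v x `^ (q + 1) * enorm x `^ (- s1))%R.
pose k x := (u x `^ (p + 1) * enorm x `^ (- s2))%R.
have f0 x : (0 <= f x)%R by rewrite mulr_ge0 ?powR_ge0.
have g0 x : (0 <= g x)%R by rewrite mulr_ge0 ?powR_ge0.
have h0 x : (0 <= h x)%R by rewrite mulr_ge0 ?powR_ge0.
have k0 x : (0 <= k x)%R by rewrite mulr_ge0 ?powR_ge0.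
have mf : measurable_fun setT f by exact: measurable_weight.
have mg : measurable_fun setT g by exact: measurable_weight.
have mh : measurable_fun setT h by exact: measurable_weight.
have mk : measurable_fun setT k by exact: measurable_weight.
have mhl := measurable_scale_comp n h l mh.
have mkl := measurable_scale_comp n k l mk.
have mgl := measurable_scale_comp n g l mg.
have mvl := measurable_scale_comp n v l mv.
(* The exchange identity at [l = 1]: the energies of [u] and [v] coincide. *)
have Ek : integral_Rn (fun x => (k x)%:E) = E%:E.
  have := energy_exchange n (n%:R - alpha)%R 1 f g u v ltr01 f0 g0 mf mg uE vE.
  rewrite powR1 mul1e -hE => H.
  transitivity (integral_Rn (fun y => (g (1 *: y) * u y)%:E)).
    apply: eq_integral_Rn => x; congr EFin.
    by rewrite /k /g scale1r -powR_mulS//; ring.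
  rewrite -H; apply: eq_integral_Rn => x; congr EFin.
  by rewrite /f scale1r -powR_mulS//; ring.
pose A := integral_Rn (fun x => (f x * v (l *: x))%:E).
pose B := integral_Rn (fun y => (g (l *: y) * u y)%:E).
have AB : A = (l `^ alpha)%:E * B.
  rewrite /A (energy_exchange n (n%:R - alpha)%R l f g u v l0 f0 g0 mf mg uE vE).
  by congr ((_ `^ _)%:E * _); ring.
have A0 : 0 <= A by apply: integral_Rn_ge0 => x; rewrite lee_fin mulr_ge0// ltW.
have B0 : 0 <= B by apply: integral_Rn_ge0 => x; rewrite lee_fin mulr_ge0// ltW.
have mgu : measurable_fun setT (fun y : 'rV[R]_n => g (l *: y) * u y)%R.
  exact: (measurable_funM mgl mu).
have mfv : measurable_fun setT (fun x : 'rV[R]_n => f x * v (l *: x))%R.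
  exact: (measurable_funM mf mvl).
have gu0 y : (0 <= g (l *: y) * u y)%R by rewrite mulr_ge0// ltW.
have fv0 x : (0 <= f x * v (l *: x))%R by rewrite mulr_ge0// ltW.
have eZ (s : R) (x : 'rV[R]_n) : (enorm (l *: x) `^ s = l `^ s * enorm x `^ s)%R.
  by rewrite enormZ gtr0_norm// powRM ?enorm_ge0// ltW.
have hl : integral_Rn (fun x => (h (l *: x))%:E) = (l `^ (- n%:R) * E)%:E.
  by rewrite integral_Rn_scale// hE.
have kl : integral_Rn (fun x => (k (l *: x))%:E) = (l `^ (- n%:R) * E)%:E.
  by rewrite integral_Rn_scale// Ek.
(* Young's inequality between [u (l y)] and [u y]; the factor [l^(- s2)] comes from the weight of
   [g (l y)]. *)
have upper : (p + 1)%:E * B <= (p * (l `^ (- n%:R) * E) + l `^ (- s2) * E)%:E.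
  rewrite -integral_RnZl; first last.
  - exact/measurable_EFinP.
  - by move=> y; rewrite lee_fin.
  - by rewrite lee_fin; lra.
  have lin := integral_Rn_lin2 n (fun x => k (l *: x)%R) k p (l `^ (- s2))%R
    (ltW p0) (powR_ge0 _ _) (fun x => k0 _) k0 mkl mk.
  rewrite kl Ek -!EFinM -EFinD in lin; rewrite -lin.
  apply: le_integral_Rn.
  - by move=> y; rewrite -EFinM lee_fin mulr_ge0//; lra.
  - by apply: measurable_funeM; exact/measurable_EFinP.
  - apply/measurable_EFinP.
    exact: (measurable_funD (measurable_funM (measurable_cst _) mkl)
      (measurable_funM (measurable_cst _) mk)).
  - move=> y; rewrite -EFinM lee_fin /g /k !eZ.
    have := powR_young (u y) (u (l *: y)) p (u0 _) (u0 _) p0.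
    have L0 : (0 <= l `^ (- s2) * enorm y `^ (- s2))%R by rewrite mulr_ge0
      ?powR_ge0.
    move=> /(ler_wpM2l L0); lra.
(* The Taylor bound for [v (l x)] around [v x]; the factor [l^s1] cancels the dilation of the weight
   in [h (l x)]. *)
have lower : (l `^ s1 * (l `^ (- n%:R) * E) + q * E)%:E <=
    (q + 1)%:E * A + (2 * ((q + 1) * (K * t)) ^+ 2 * E)%:E.
  have D0 : (0 <= 2 * ((q + 1) * (K * t)) ^+ 2)%R by rewrite mulr_ge0 ?sqr_ge0.
  have lin1 := integral_Rn_lin2 n (fun x => h (l *: x)%R) h (l `^ s1)%R q
    (powR_ge0 _ _) (ltW q0) (fun x => h0 _) h0 mhl mh.
  have lin2 := integral_Rn_lin2 n (fun x => f x * v (l *: x))%R h (q + 1)%R _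
    (addr_ge0 (ltW q0) ler01) D0 fv0 h0 mfv mh.
  rewrite hl hE -!EFinM -EFinD in lin1; rewrite -lin1.
  rewrite hE -!EFinM in lin2; rewrite -lin2.
  apply: le_integral_Rn.
  - by move=> x; rewrite lee_fin addr_ge0// mulr_ge0 ?powR_ge0// ltW.
  - apply/measurable_EFinP.
    exact: (measurable_funD (measurable_funM (measurable_cst _) mhl)
      (measurable_funM (measurable_cst _) mh)).
  - apply/measurable_EFinP.
    exact: (measurable_funD (measurable_funM (measurable_cst _) mfv)
      (measurable_funM (measurable_cst _) mh)).
  - move=> x; rewrite lee_fin /h /f eZ.
    set L := ln (v (l *: x) / v x).
    have hL : (`|L| <= K * t)%R by exact: lip.
    have hq : ((q + 1) * `|L| <= 2^-1)%R.
      by apply: le_trans small; rewrite ler_wpM2l//; lra.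
    have L2 : (2 * ((q + 1) * L) ^+ 2 <= 2 * ((q + 1) * (K * t)) ^+ 2)%R.
      rewrite ler_wpM2l// -[X in (X <= _)%R]real_normK ?num_real// ler_pXn2r
        ?nnegrE//.
      + by rewrite normrM gtr0_norm ?ler_wpM2l//; lra.
      + by rewrite mulr_ge0 ?mulr_ge0//; lra.
    have T := powR_taylor (v x) (v (l *: x)) q (v0 _) (v0 _) q0 hq.
    have L3 : (2 * ((q + 1) * L) ^+ 2 * v x `^ (q + 1) <=
       2 * ((q + 1) * (K * t)) ^+ 2 * v x `^ (q + 1))%R by rewrite ler_wpM2r
         ?powR_ge0.
    have T' := le_trans T (lerD (lexx _) L3).
    have e0 : (0 <= enorm x `^ (- s1))%R by exact: powR_ge0.
    have ll : (l `^ s1 * l `^ (- s1) = 1)%R by rewrite -powRD_gt0// subrr powRr0.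
    rewrite [leLHS](_ : _ = enorm x `^ (- s1) * (l `^ s1 * l `^ (- s1) * v (l
      *: x) `^ (q + 1) + q * v x `^ (q + 1)))%R; last by ring.
    rewrite ll mul1r.
    apply: le_trans (ler_wpM2l e0 T') _.
    by rewrite le_eqVlt; apply/orP; left; apply/eqP; ring.
(* Finiteness of [B] follows from [upper] and allows the passage to real inequalities. *)
have Boo : B \is a fin_num.
  rewrite ge0_fin_numE//; move: upper; case: (B) B0 => [r _ _| _|//]; first
    exact: ltry.
  by rewrite gt0_muley ?lte_fin//; lra.
move: upper lower; rewrite AB -(fineK Boo) -!EFinM -EFinD !lee_fin.
set b := fine B => upper lower.
have p1 : (0 < p + 1)%R by lra.
have q1 : (0 < q + 1)%R by lra.
have b1 : (b <= (p * l `^ (- n%:R) + l `^ (- s2)) / (p + 1) * E)%R.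
  by rewrite mulrAC ler_pdivlMr//; lra.
have la0 : (0 <= l `^ alpha)%R by exact: powR_ge0.
have b2 : (l `^ alpha * b <= l `^ alpha * ((p * l `^ (- n%:R) + l `^ (- s2)) /
  (p + 1) * E))%R.
  by rewrite ler_wpM2l.
have b3 := ler_wpM2l (ltW q1) b2.
rewrite -(ler_pM2r E0).
rewrite (_ : expR _ = l `^ s1 * l `^ (- n%:R))%R; last first.
  by rewrite -powRD_gt0// lpow; congr expR; ring.
rewrite (_ : expR ((n%:R - alpha) * t) = l `^ alpha * l `^ (- n%:R))%R; last
  first.
  by rewrite -powRD_gt0// lpow; congr expR; ring.
rewrite (_ : expR ((s2 - alpha) * t) = l `^ alpha * l `^ (- s2))%R; last first.
  by rewrite -powRD_gt0// lpow; congr expR; ring.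
rewrite [leLHS](_ : _ = l `^ s1 * (l `^ (- n%:R) * E) + q * E)%R; last by ring.
apply: (le_trans lower).
rewrite [leRHS](_ : _ = (q + 1) * (l `^ alpha * ((p * l `^ (- n%:R) + l `^ (-
  s2)) / (p + 1) * E))
   + 2 * ((q + 1) * (K * t)) ^+ 2 * E)%R; last by field; rewrite gt_eqF.
by rewrite lerD2r.
Qed.

End Nonexistence.

Theorem theorem1p2 (R : realType) (n : nat) (p q alpha sigma1 sigma2 : R) :
  (3 <= n)%N -> 0 < p -> 0 < q -> 1 < p * q ->
  1 < alpha -> alpha < n%:R ->
  0 <= sigma1 -> sigma1 < alpha -> 0 <= sigma2 -> sigma2 < alpha ->
  (n%:R - sigma1) / (1 + q) + (n%:R - sigma2) / (1 + p) > n%:R - alpha ->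
  ~ exists u v : 'rV[R]_n -> R,
      [/\ (classical alpha u /\ classical alpha v),
          ((forall x, 0 < u x) /\ (forall x, 0 < v x)),
          (bounded_fun_Rn u /\ bounded_fun_Rn v),
          (exists theta1 theta2 : R, [/\ 0 < theta1, 0 < theta2,
               simeq_pow u theta1 & simeq_pow v theta2]) &
          (forall x, (u x)%:E = riesz_op alpha sigma1 q v x /\
                     (v x)%:E = riesz_op alpha sigma2 p u x)].
Proof.
move=> n3 p0 q0 pq a1 an s10 s1a s20 s2a sub [u [v [[[_ cu] [_ cv]] [u0 v0]
  [[Mu hMu] [Mv hMv]] [th1 [th2 [th10 th20 du dv]]] eqs]]].
have n0 : (0 < n)%N by exact: leq_trans n3.
have uM x : u x <= Mu by exact: le_trans (ler_norm _) (hMu x).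
have vM x : v x <= Mv by exact: le_trans (ler_norm _) (hMv x).
have mu : measurable_fun setT u by exact: continuous_measurable_fun_row.
have mv : measurable_fun setT v by exact: continuous_measurable_fun_row.
have uE x : (u x)%:E = potential n (n%:R - alpha) (fun y => v y `^ q * enorm y
  `^ (- sigma1)) x.
  by rewrite (eqs x).1 riesz_opE.
have vE x : (v x)%:E = potential n (n%:R - alpha) (fun y => u y `^ p * enorm y
  `^ (- sigma2)) x.
  by rewrite (eqs x).2 riesz_opE.
have u_ge0 x : 0 <= u x by exact: ltW.
have v_ge0 x : 0 <= v x by exact: ltW.
have f0 x : 0 <= v x `^ q * enorm x `^ (- sigma1) by rewrite mulr_ge0 ?powR_ge0.
have g0 x : 0 <= u x `^ p * enorm x `^ (- sigma2) by rewrite mulr_ge0 ?powR_ge0.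
have mf := measurable_weight n v q (- sigma1) mv.
have mg := measurable_weight n u p (- sigma2) mu.
have [Hu Hu0 har_u] := harnack_of_decay n u Mu th1 cu u0 uM th10 du.
have [Hv Hv0 har_v] := harnack_of_decay n v Mv th2 cv v0 vM th20 dv.
have har_f := harnackM n _ _ _ _ (fun x => powR_ge0 (v x) q) (fun x => powR_ge0
  (enorm x) (- sigma1))
  (harnack_powR n Hv v q (ltW Hv0) (ltW q0) v_ge0 har_v) (harnack_enorm n
    sigma1 s10).
have har_g := harnackM n _ _ _ _ (fun x => powR_ge0 (u x) p) (fun x => powR_ge0
  (enorm x) (- sigma2))
  (harnack_powR n Hu u p (ltW Hu0) (ltW p0) u_ge0 har_u) (harnack_enorm n
    sigma2 s20).
have Hf0 : 0 < Hv `^ q * 2 `^ sigma1 by rewrite mulr_gt0 ?powR_gt0.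
have Hg0 : 0 < Hu `^ p * 2 `^ sigma2 by rewrite mulr_gt0 ?powR_gt0.
have b0 : 0 < n%:R - alpha by lra.
(* This is [alpha > 1]: the kernel of exponent [n - alpha + 1] is locally integrable. *)
have b1 : n%:R - alpha + 1 < n%:R by lra.
have nba : n%:R - (n%:R - alpha) = alpha by ring.
have [c1 c10 low1] := potential_lower n (n%:R - alpha) _ n0 (ltW b0) Hf0.
have [c2 c20 low2] := potential_lower n (n%:R - alpha) _ n0 (ltW b0) Hg0.
have lowu x : 0 < enorm x ->
    c1 * (v x `^ q * enorm x `^ (- sigma1) * enorm x `^ alpha) <= u x.
  by move=> x0; have := low1 _ f0 mf har_f x x0; rewrite -uE lee_fin nba.
have lowv x : 0 < enorm x ->
    c2 * (u x `^ p * enorm x `^ (- sigma2) * enorm x `^ alpha) <= v x.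
  by move=> x0; have := low2 _ g0 mg har_g x x0; rewrite -vE lee_fin nba.
have [C C0 decay] := decay_bootstrap n u v p q alpha sigma1 sigma2 c1 c2
  p0 q0 pq c10 c20 u0 v0 lowu lowv.
set theta := (_ / _) in decay.
have pq0 : 0 < p * q - 1 by lra.
have p1 : 0 < 1 + p by lra.
have q1 : 0 < 1 + q by lra.
have sub' : (n%:R - alpha) * ((1 + p) * (1 + q)) <
    (n%:R - sigma1) * (1 + p) + (n%:R - sigma2) * (1 + q).
  rewrite -ltr_pdivlMr ?mulr_gt0//.
  rewrite (_ : _ / _ = (n%:R - sigma1) / (1 + q) + (n%:R - sigma2) / (1 + p))//.
  by field; rewrite !gt_eqF.
(* After multiplication by [p q - 1] this is a rearrangement of [sub']. *)
have integ : n%:R < (q + 1) * theta + sigma1.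
  rewrite -(ltr_pM2r pq0) mulrDl -mulrA divfK ?gt_eqF//; lra.
have q10 : 0 <= q + 1 by lra.
have E1 := energy_fin n v (q + 1) sigma1 theta Mv C q10 (lt_trans s1a an) s10
  integ mv v0 vM C0 decay.
have [m m0 vm] := continuous_pos_lower_bound n v 1 ler01 cv v0.
have E2 := energy_gt0 n v (q + 1) sigma1 m n0 q10 s10 mv v0 m0 vm.
have [E [E0 EE]] : exists E : R, 0 < E /\
   integral_Rn (fun x => (v x `^ (q + 1) * enorm x `^ (- sigma1))%:E) = E%:E.
  move: E1 E2; case: (integral_Rn _) => [E||] //= _ E0.
  by exists E; rewrite -lte_fin.
have [K [t0 [K0 t00 lip]]] := log_lipschitz n (n%:R - alpha) _ n0 b0 b1 Hg0.
(* Chosen so that [(q + 1) K t <= 1/2]; the [+ 1] keeps the denominator positive when [K = 0]. *)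
pose t1 := (2 * ((q + 1) * K + 1))^-1.
have qK : 0 <= (q + 1) * K by rewrite mulr_ge0.
have t10 : 0 < t1 by rewrite invr_gt0; lra.
have tmin : 0 < Num.min t0 t1 by rewrite lt_min t00.
have := first_order_comparison (n%:R - sigma1) (n%:R - alpha) (sigma2 - alpha) p q
  (2 * ((q + 1) * K) ^+ 2) (Num.min t0 t1) p0 q0 _ tmin.
have key : forall t, 0 < t -> t <= Num.min t0 t1 ->
  expR ((n%:R - sigma1) * t) + q <=
    (q + 1) / (p + 1) * (p * expR ((n%:R - alpha) * t) + expR ((sigma2 - alpha)
      * t)) +
    2 * ((q + 1) * K) ^+ 2 * t ^+ 2.
  move=> t tp; rewrite le_min => /andP[tt0 tt1].
  apply: (dilation_inequality n p q alpha sigma1 sigma2 K t E u v) => //.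
    by move=> x; exact: (lip _ v g0 mg har_g v0 vE).
  rewrite mulrA (@le_trans _ _ ((q + 1) * K * t1))//; first by rewrite ler_wpM2l.
  rewrite /t1 ler_pdivrMr; lra.
move=> /(_ _ key) concl.
have {}concl : n%:R - sigma1 <= (q + 1) / (p + 1) * (p * (n%:R - alpha) +
  (sigma2 - alpha)).
  by apply: concl; rewrite mulr_ge0 ?sqr_ge0.
(* Multiplying by [p + 1] and adding [(n - sigma2) (1 + q)] to both sides gives the reverse of
   [sub']. *)
move: concl; rewrite mulrAC ler_pdivlMr; last by lra.
lra.
Qed.
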